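(* Let $K$ be a field of characteristic $0$, $m\ge 2$, and let $\widehat{F_m}$ be the completion, with respect to the formal power series topology, of the free metabelian Lie algebra $F_m$ of rank $m$ over $K$. Let $u,v\in\widehat{F_m}$, and write $u=\overline{u}+u_0$, $v=\overline{v}+v_0$, where $\overline{u},\overline{v}$ are the linear (degree $1$) components of $u,v$ and $u_0,v_0\in\widehat{F_m'}$. Then the solution $w=w(u,v)\in\widehat{F_m}$ of the equation $\exp(\mathrm{ad}\,u)\cdot\exp(\mathrm{ad}\,v)=\exp(\mathrm{ad}\,w)$ is \[ w=H(\overline{u},\overline{v})+u_0\bigl(1+(\mathrm{ad}\,\overline{v})\,c(\mathrm{ad}\,\overline{u},\mathrm{ad}\,\overline{v})\bigr)+v_0\bigl(1-(\mathrm{ad}\,\overline{u})\,c(\mathrm{ad}\,\overline{u},\mathrm{ad}\,\overline{v})\bigr), \] where \[ H(\overline{u},\overline{v})=\overline{u}+\overline{v}+[\overline{u},\overline{v}]\,c(\mathrm{ad}\,\overline{u},\mathrm{ad}\,\overline{v}), \] \[ c(t_1,t_2)=\frac{e^{t_2}h(t_1)-h(t_2)}{e^{t_1+t_2}-1}\in K[[t_1,t_2]],\qquad h(t)=\frac{e^t-1}{t}\in K[[t]]. \]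
   Context: $L_m$ is the free Lie algebra over $K$ on $x_1,\dots,x_m$, and $F_m=L_m/L_m''$ is the free metabelian Lie algebra with free generators $y_i=x_i+L_m''$; $F_m'=[F_m,F_m]$. $F_m$ is graded by total degree in $y_1,\dots,y_m$, with homogeneous components $(F_m)_{(k)}$. The formal power series topology on $F_m$ is the one in which the sets $r+F_m^k$ ($r\in F_m$, $k\ge1$) form a basis of open sets, where $F_m^k$ is the $k$-th term of the lower central series. The completion $\widehat{F_m}$ consists of the formal infinite sums $f=f_1+f_2+\cdots$ with $f_k\in(F_m)_{(k)}$; $\widehat{F_m'}$ is its commutator ideal, consisting of the series with $f_1=0$. Operators $\mathrm{ad}\,v$ are written on the right: $u(\mathrm{ad}\,v)=[u,v]$, and products of operators are accordingly right compositions, so that $x\bigl(\exp(\mathrm{ad}\,u)\cdot\exp(\mathrm{ad}\,v)\bigr)=\bigl(x\exp(\mathrm{ad}\,u)\bigr)\exp(\mathrm{ad}\,v)$. For $u\in\widehat{F_m}$, $\exp(\mathrm{ad}\,u)=\sum_{k\ge0}(\mathrm{ad}\,u)^k/k!$, a (continuous) automorphism of $\widehat{F_m}$, called inner. On $\widehat{F_m'}$ the operators $\mathrm{ad}\,\overline u$ and $\mathrm{ad}\,\overline v$ commute, so power series in them act on $\widehat{F_m'}$. In $c(t_1,t_2)$ both numerator and denominator are divisible by $t_1+t_2$ in $K[[t_1,t_2]]$; after cancelling this common factor the denominator is invertible, and $c$ denotes the resulting element of $K[[t_1,t_2]]$. *)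

(* Defs.v *)
From HB Require Import structures.
From mathcomp Require Import all_boot all_order all_algebra.
From mathcomp Require Import ring lra zify.
From mathcomp Require Import boolp classical_sets functions.

Set Implicit Arguments.
Unset Strict Implicit.
Unset Printing Implicit Defensive.

Import GRing.Theory.

Local Open Scope classical_set_scope.
Local Open Scope ring_scope.

Section Convolution.
Variable V : zmodType.

Lemma conv_sym (n : nat) (G : nat -> nat -> V) :
  \sum_(i < n.+1) G i (n - i)%N = \sum_(i < n.+1) G (n - i)%N i.
Proof.
rewrite (reindex_inj rev_ord_inj); apply: eq_bigr => i _ /=.
by rewrite subSS subKn // -ltnS.
Qed.

Lemma conv_assoc (n : nat) (G : nat -> nat -> nat -> V) :
  \sum_(i < n.+1) \sum_(j < i.+1) G j (i - j)%N (n - i)%N =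
  \sum_(i < n.+1) \sum_(j < (n - i).+1) G i j (n - i - j)%N.
Proof.
pose P (i j : nat) := (j <= i)%N.
transitivity (\sum_(i < n.+1) \sum_(j < n.+1 | P i j)
    G j (i - j)%N (n - i)%N).
  apply: eq_bigr => i _.
  by rewrite (big_ord_widen n.+1 (fun j => G j (i - j)%N (n - i)%N)).
rewrite (exchange_big_dep predT) //=; apply: eq_bigr => j _.
rewrite -(big_mkord (fun i => P i j) (fun i => G j (i - j)%N (n - i)%N)).
rewrite (big_cat_nat (n := j)) //=; last by rewrite ltnW.
rewrite big_nat_cond big1 ?add0r; last first.
  by move=> i /andP[/andP[_ ij]]; rewrite /P leqNgt ij.
rewrite -{1}[nat_of_ord j]add0n big_addn big_mkord subSn -1?ltnS //.
apply: eq_big => [i|i _]; first by rewrite /P leq_addl.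
by rewrite addnK addnC subnDA.
Qed.

Lemma conv_cycle (n : nat) (G : nat -> nat -> nat -> V) :
  \sum_(i < n.+1) \sum_(j < (n - i).+1) G i j (n - i - j)%N =
  \sum_(i < n.+1) \sum_(j < (n - i).+1) G j (n - i - j)%N i.
Proof.
rewrite -conv_assoc.
pose H a b := \sum_(j < a.+1) G j (a - j)%N b.
exact: (conv_sym n H).
Qed.

End Convolution.

Record fps (R : Type) := Fps { coefs : nat -> R }.

Section FpsTheory.
Variable R : comNzRingType.
Implicit Types p q r : fps R.

Lemma fpsP p q : coefs p =1 coefs q -> p = q.
Proof. by case: p q => [p] [q] /= /funext ->. Qed.

HB.instance Definition _ := gen_eqMixin (fps R).
HB.instance Definition _ := gen_choiceMixin (fps R).

Definition fps_add p q := Fps (fun n => coefs p n + coefs q n).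
Definition fps_opp p := Fps (fun n => - coefs p n).
Definition fpsC (a : R) := Fps (fun n => if n == 0 then a else 0).
Definition fpsX : fps R := Fps (fun n => (n == 1)%:R).
Definition fps_mul p q :=
  Fps (fun n => \sum_(i < n.+1) coefs p i * coefs q (n - i)).

Fact fps_addA : associative fps_add.
Proof. by move=> p q r; apply: fpsP => n /=; rewrite addrA. Qed.
Fact fps_addC : commutative fps_add.
Proof. by move=> p q; apply: fpsP => n /=; rewrite addrC. Qed.
Fact fps_add0 : left_id (fpsC 0) fps_add.
Proof. by move=> p; apply: fpsP => n /=; rewrite if_same add0r. Qed.
Fact fps_addN : left_inverse (fpsC 0) fps_opp fps_add.
Proof. by move=> p; apply: fpsP => n /=; rewrite addNr if_same. Qed.

HB.instance Definition _ := GRing.isZmodule.Build (fps R)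
  fps_addA fps_addC fps_add0 fps_addN.

Fact fps_mulA : associative fps_mul.
Proof.
move=> p q r; apply: fpsP => n /=.
under eq_bigr do rewrite mulr_sumr.
under [RHS]eq_bigr do rewrite mulr_suml.
rewrite (conv_assoc n (fun i j k => coefs p i * coefs q j * coefs r k)).
by do 2![apply: eq_bigr => ? _]; rewrite mulrA.
Qed.
Fact fps_mulC : commutative fps_mul.
Proof.
move=> p q; apply: fpsP => n /=.
rewrite (conv_sym n (fun i j => coefs p i * coefs q j)).
by apply: eq_bigr => i _; rewrite mulrC.
Qed.
Fact fps_mul1 : left_id (fpsC 1) fps_mul.
Proof.
move=> p; apply: fpsP => n /=.
rewrite big_ord_recl /= mul1r subn0 big1 ?addr0 // => i _.
by rewrite mul0r.
Qed.
Fact fps_mulD : left_distributive fps_mul +%R.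
Proof.
move=> p q r; apply: fpsP => n /=; rewrite -big_split /=.
by apply: eq_bigr => i _; rewrite mulrDl.
Qed.
Fact fps_1neq0 : fpsC 1 != 0.
Proof.
apply/eqP => /(congr1 (fun p => coefs p 0)) /= /eqP.
by rewrite oner_eq0.
Qed.

HB.instance Definition _ := GRing.Zmodule_isComNzRing.Build (fps R)
  fps_mulA fps_mulC fps_mul1 fps_mulD fps_1neq0.

Lemma coef_fps0 n : coefs (0 : fps R) n = 0.
Proof. exact: if_same. Qed.
Lemma coef_fps1 n : coefs (1 : fps R) n = (n == 0)%:R.
Proof. by rewrite /GRing.one /=; case: eqP. Qed.
Lemma coef_fpsD p q n : coefs (p + q) n = coefs p n + coefs q n.
Proof. by []. Qed.
Lemma coef_fpsN p n : coefs (- p) n = - coefs p n.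
Proof. by []. Qed.
Lemma coef_fpsM p q n :
  coefs (p * q) n = \sum_(i < n.+1) coefs p i * coefs q (n - i).
Proof. by []. Qed.

Lemma coef_fps_sum I (r : seq I) (P : pred I) (F : I -> fps R) n :
  coefs (\sum_(i <- r | P i) F i) n = \sum_(i <- r | P i) coefs (F i) n.
Proof.
by elim/big_rec2: _ => [|i x y _ <-]; rewrite ?coef_fps0 ?coef_fpsD.
Qed.

Lemma coef_fpsCM a p n : coefs (fpsC a * p) n = a * coefs p n.
Proof.
rewrite coef_fpsM big_ord_recl /= subn0 big1 ?addr0 // => i _.
exact: mul0r.
Qed.

Lemma coef_fpsXM p n :
  coefs (fpsX * p) n = if n is n'.+1 then coefs p n' else 0.
Proof.
rewrite coef_fpsM; case: n => [|n]; first by rewrite big_ord1; apply: mul0r.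
rewrite big_ord_recl [X in X + _]mul0r add0r big_ord_recl.
rewrite big1 ?addr0 => [|i _]; last exact: mul0r.
by rewrite [LHS]mul1r subSS subn0.
Qed.

(* The fraction [p / q] when [q] divides [p], and [0] otherwise. The quotient is
   unique when [q] is not a zero divisor, cf. [fps_mulf_eq0]. *)
Definition fps_div p q := xget 0 [set r | r * q = p].

Lemma fps_divP p q : (exists r, r * q = p) -> fps_div p q * q = p.
Proof. exact: xgetPex. Qed.

Lemma fps_inv_exists p (a : R) : a * coefs p 0 = 1 -> exists q, q * p = 1.
Proof.
move=> ap.
pose next (s : seq R) :=
  a * ((size s == 0)%:R - \sum_(i < size s) s`_i * coefs p (size s - i)).
pose S n := iter n (fun s => rcons s (next s)) [::].
have sizeS n : size (S n) = n.
  by elim: n => //= n IH; rewrite size_rcons IH.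
pose q := Fps (fun n => next (S n)).
have nthS n i : (i < n)%N -> (S n)`_i = coefs q i.
  elim: n => // n IH; rewrite ltnS leq_eqVlt => /predU1P[->|lin] /=.
    by rewrite nth_rcons sizeS ltnn eqxx.
  by rewrite nth_rcons sizeS lin IH.
exists q; apply: fpsP => n; rewrite coef_fpsM coef_fps1 big_ord_recr /= subnn.
rewrite {2}/next mulrAC ap mul1r sizeS addrC -addrA.
under [X in - X]eq_bigr => i _ do rewrite nthS //.
by rewrite addNr addr0.
Qed.

End FpsTheory.

Lemma fps_mulf_eq0 (R : comNzRingType) (p q : fps R) :
    (forall a b : R, a * b = 0 -> a = 0 \/ b = 0) ->
  p * q = 0 -> p = 0 \/ q = 0.
Proof.
move=> dom pq0; apply: contrapT => /not_orP[p0 q0].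
have nz (r : fps R) : r <> 0 -> exists n, coefs r n != 0.
  move=> r0; apply: contrapT => /forallNP H; apply: r0; apply: fpsP => n.
  by rewrite coef_fps0; apply/eqP/negPn/negP/H.
case: (ex_minnP (nz p p0)) => i pi mini.
case: (ex_minnP (nz q q0)) => j qj minj.
have := congr1 (fun r => coefs r (i + j)) pq0.
rewrite coef_fpsM coef_fps0.
have ilt : (i < (i + j).+1)%N by rewrite ltnS leq_addr.
rewrite (bigD1 (Ordinal ilt)) //= addKn big1 ?addr0.
  by move/dom => [] /eqP; rewrite ?(negPf pi) ?(negPf qj).
move=> k; rewrite -val_eqE neq_ltn /= => /orP[ki|ik].
  rewrite [coefs p k](_ : _ = 0) ?mul0r //; apply/eqP/negPn/negP => /mini.
  by rewrite leqNgt ki.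
rewrite [coefs q _](_ : _ = 0) ?mulr0 //; apply/eqP/negPn/negP => /minj.
have := ltn_ord k; lia.
Qed.

HB.mixin Record Lmodule_isLie (K : fieldType) L of GRing.Lmodule K L := {
  lieb : L -> L -> L;
  liebDl : forall x y z, lieb (x + y) z = lieb x z + lieb y z;
  liebZl : forall a x y, lieb (a *: x) y = a *: lieb x y;
  liebDr : forall x y z, lieb x (y + z) = lieb x y + lieb x z;
  liebZr : forall a x y, lieb x (a *: y) = a *: lieb x y;
  liebxx : forall x, lieb x x = 0;
  lieb_jacobi : forall x y z,
    lieb x (lieb y z) + lieb y (lieb z x) + lieb z (lieb x y) = 0 }.

#[short(type="lieAlgType")]
HB.structure Definition LieAlgebra (K : fieldType) :=
  {L of GRing.Lmodule K L & Lmodule_isLie K L}.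

Notation "⟦ x , y ⟧" := (lieb x y)
  (at level 0, x, y at level 99, format "⟦ x ,  y ⟧") : ring_scope.

Inductive lspan (K : fieldType) (V : lmodType K) (S : set V) : set V :=
| lspan0 : lspan S 0
| lspanZD a x y of S x & lspan S y : lspan S (a *: x + y).

Section LieTheory.
Variables (K : fieldType).

Section Span.
Variables (V : lmodType K) (S : set V).

Lemma lspan_sub x : S x -> lspan S x.
Proof.
by move=> Sx; rewrite -[x]addr0 -[x]scale1r; apply: lspanZD => //; left.
Qed.

Lemma lspanD x y : lspan S x -> lspan S y -> lspan S (x + y).
Proof.
move=> Sx Sy; elim: Sx => [|a z t Sz _ IH]; first by rewrite add0r.
by rewrite -addrA; apply: lspanZD.
Qed.

Lemma lspanZ a x : lspan S x -> lspan S (a *: x).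
Proof.
elim=> [|b z t Sz _ IH]; first by rewrite scaler0; left.
by rewrite scalerDr scalerA; apply: lspanZD.
Qed.

Lemma lspanN x : lspan S x -> lspan S (- x).
Proof. by rewrite -scaleN1r; apply: lspanZ. Qed.

Lemma lspan_sum I (r : seq I) (P : pred I) (F : I -> V) :
  (forall i, P i -> lspan S (F i)) -> lspan S (\sum_(i <- r | P i) F i).
Proof.
move=> H; elim/big_ind: _ => //; [exact: lspan0 | exact: lspanD].
Qed.

End Span.

Section Bracket.
Variable L : lieAlgType K.
Implicit Types x y z : L.

Lemma lieb0 x : ⟦x, 0⟧ = 0.
Proof. by have := liebZr 0 x 0; rewrite !scale0r. Qed.
Lemma lie0b x : ⟦0, x⟧ = 0.
Proof. by have := liebZl 0 0 x; rewrite !scale0r. Qed.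
Lemma liebC x y : ⟦x, y⟧ = - ⟦y, x⟧.
Proof.
apply/eqP; rewrite -addr_eq0; apply/eqP.
by have := liebxx (x + y); rewrite liebDl !liebDr !liebxx add0r addr0.
Qed.
Lemma liebNr x y : ⟦x, - y⟧ = - ⟦x, y⟧.
Proof. by rewrite -scaleN1r liebZr scaleN1r. Qed.
Lemma liebNl x y : ⟦- x, y⟧ = - ⟦x, y⟧.
Proof. by rewrite -scaleN1r liebZl scaleN1r. Qed.
Lemma lieb_suml I (r : seq I) (P : pred I) (F : I -> L) y :
  ⟦\sum_(i <- r | P i) F i, y⟧ = \sum_(i <- r | P i) ⟦F i, y⟧.
Proof. by elim/big_rec2: _ => [|i a b _ <-]; rewrite ?lie0b ?liebDl. Qed.
Lemma lieb_sumr I (r : seq I) (P : pred I) (F : I -> L) y :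
  ⟦y, \sum_(i <- r | P i) F i⟧ = \sum_(i <- r | P i) ⟦y, F i⟧.
Proof. by elim/big_rec2: _ => [|i a b _ <-]; rewrite ?lieb0 ?liebDr. Qed.

Definition lie_comm (A B : set L) : set L :=
  lspan [set z | exists x y, [/\ A x, B y & z = ⟦x, y⟧]].

Definition derived1 : set L := lie_comm setT setT.
Definition derived2 : set L := lie_comm derived1 derived1.

Lemma derived1_br x y : derived1 ⟦x, y⟧.
Proof. by apply: lspan_sub; exists x, y; split. Qed.

Lemma derived2_ideal x y : derived2 x -> derived2 ⟦x, y⟧.
Proof.
elim=> [|a z t [p [q [p1 q1 ->]]] _ IH]; first by rewrite lie0b; left.
rewrite liebDl liebZl; apply: lspanD => //; apply: lspanZ.
have -> : ⟦⟦p, q⟧, y⟧ = ⟦p, ⟦q, y⟧⟧ + ⟦q, ⟦y, p⟧⟧.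
  by rewrite [LHS]liebC; apply/eqP; rewrite eq_sym -addr_eq0 lieb_jacobi.
apply: lspanD; apply: lspan_sub.
  by exists p, ⟦q, y⟧; split=> //; apply: derived1_br.
by exists q, ⟦y, p⟧; split=> //; apply: derived1_br.
Qed.

End Bracket.

Definition is_lie_hom (L L' : lieAlgType K) (f : L -> L') : Prop :=
  (forall a x y, f (a *: x + y) = a *: f x + f y) /\
  (forall x y, f ⟦x, y⟧ = ⟦f x, f y⟧).

Section FreeLie.
Variable m : nat.

Inductive lie_term : Type :=
| LVar of 'I_m
| LZero
| LAdd of lie_term & lie_term
| LScale of K & lie_term
| LBr of lie_term & lie_term.

(* The smallest congruence turning terms into a Lie algebra over [K]. *)
Inductive lie_cong : lie_term -> lie_term -> Prop :=
| lc_refl s : lie_cong s s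
| lc_sym s t of lie_cong s t : lie_cong t s
| lc_trans s t u of lie_cong s t & lie_cong t u : lie_cong s u
| lc_add s s' t t' of lie_cong s s' & lie_cong t t' :
    lie_cong (LAdd s t) (LAdd s' t')
| lc_scale a s s' of lie_cong s s' : lie_cong (LScale a s) (LScale a s')
| lc_br s s' t t' of lie_cong s s' & lie_cong t t' :
    lie_cong (LBr s t) (LBr s' t')
| lc_addA s t u : lie_cong (LAdd s (LAdd t u)) (LAdd (LAdd s t) u)
| lc_addC s t : lie_cong (LAdd s t) (LAdd t s)
| lc_add0 s : lie_cong (LAdd LZero s) s
| lc_addN s : lie_cong (LAdd (LScale (-1) s) s) LZero
| lc_scaleA a b s : lie_cong (LScale a (LScale b s)) (LScale (a * b) s)
| lc_scale1 s : lie_cong (LScale 1 s) s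
| lc_scaleDr a s t :
    lie_cong (LScale a (LAdd s t)) (LAdd (LScale a s) (LScale a t))
| lc_scaleDl a b s :
    lie_cong (LScale (a + b) s) (LAdd (LScale a s) (LScale b s))
| lc_brDl s t u : lie_cong (LBr (LAdd s t) u) (LAdd (LBr s u) (LBr t u))
| lc_brZl a s t : lie_cong (LBr (LScale a s) t) (LScale a (LBr s t))
| lc_brDr s t u : lie_cong (LBr s (LAdd t u)) (LAdd (LBr s t) (LBr s u))
| lc_brZr a s t : lie_cong (LBr s (LScale a t)) (LScale a (LBr s t))
| lc_brxx s : lie_cong (LBr s s) LZero
| lc_jacobi s t u : lie_cong
    (LAdd (LAdd (LBr s (LBr t u)) (LBr t (LBr u s))) (LBr u (LBr s t))) LZero.

HB.instance Definition _ := gen_eqMixin lie_term.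
HB.instance Definition _ := gen_choiceMixin lie_term.

Definition lie_congb (s t : lie_term) : bool := `[< lie_cong s t >].

Fact lie_congb_refl : reflexive lie_congb.
Proof. by move=> s; apply/asboolP; apply: lc_refl. Qed.
Fact lie_congb_sym : symmetric lie_congb.
Proof. by move=> s t; apply/asboolP/asboolP; apply: lc_sym. Qed.
Fact lie_congb_trans : transitive lie_congb.
Proof.
by move=> t s u /asboolP st /asboolP tu; apply/asboolP; apply: lc_trans tu.
Qed.

Canonical lie_cong_equiv :=
  EquivRel lie_congb lie_congb_refl lie_congb_sym lie_congb_trans.

Definition free_lie := {eq_quot lie_congb}%qT.
HB.instance Definition _ := Choice.on free_lie.
HB.instance Definition _ := EqQuotient.on free_lie.

Local Notation cls := (\pi_free_lie)%qT.

Lemma free_lie_eqP s t : reflect (lie_cong s t) (cls s == cls t).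
Proof. by rewrite eqmodE; apply: asboolP. Qed.

Lemma free_lie_eq s t : lie_cong s t -> cls s = cls t.
Proof. by move/free_lie_eqP/eqP. Qed.

Lemma free_lie_repr s : lie_cong (repr (cls s)) s.
Proof. by apply/free_lie_eqP; rewrite reprK. Qed.

Definition fl_add := lift_op2 free_lie LAdd.
Definition fl_scale a := lift_op1 free_lie (LScale a).
Definition fl_br := lift_op2 free_lie LBr.
Definition fl_gen (i : 'I_m) : free_lie := cls (LVar i).

Lemma fl_addE s t : fl_add (cls s) (cls t) = cls (LAdd s t).
Proof.
by unlock fl_add; apply/free_lie_eq/lc_add; apply: free_lie_repr.
Qed.
Lemma fl_scaleE a s : fl_scale a (cls s) = cls (LScale a s).
Proof.
by unlock fl_scale; apply/free_lie_eq/lc_scale; apply: free_lie_repr.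
Qed.
Lemma fl_brE s t : fl_br (cls s) (cls t) = cls (LBr s t).
Proof.
by unlock fl_br; apply/free_lie_eq/lc_br; apply: free_lie_repr.
Qed.
Definition flE := (fl_addE, fl_scaleE, fl_brE).

Fact fl_addA : associative fl_add.
Proof.
move=> x y z; rewrite -[x]reprK -[y]reprK -[z]reprK !flE.
exact/free_lie_eq/lc_addA.
Qed.
Fact fl_addC : commutative fl_add.
Proof.
by move=> x y; rewrite -[x]reprK -[y]reprK !flE; apply/free_lie_eq/lc_addC.
Qed.
Fact fl_add0 : left_id (cls LZero) fl_add.
Proof. by move=> x; rewrite -[x]reprK !flE; apply/free_lie_eq/lc_add0. Qed.
Fact fl_addN : left_inverse (cls LZero) (fl_scale (-1)) fl_add.
Proof. by move=> x; rewrite -[x]reprK !flE; apply/free_lie_eq/lc_addN. Qed.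

HB.instance Definition _ := GRing.isZmodule.Build free_lie
  fl_addA fl_addC fl_add0 fl_addN.

Fact fl_scaleA a b x : fl_scale a (fl_scale b x) = fl_scale (a * b) x.
Proof. by rewrite -[x]reprK !flE; apply/free_lie_eq/lc_scaleA. Qed.
Fact fl_scale1 : left_id 1 fl_scale.
Proof. by move=> x; rewrite -[x]reprK !flE; apply/free_lie_eq/lc_scale1. Qed.
Fact fl_scaleDr : right_distributive fl_scale +%R.
Proof.
move=> a x y; rewrite -[x]reprK -[y]reprK /GRing.add /= !flE.
exact/free_lie_eq/lc_scaleDr.
Qed.
Fact fl_scaleDl x : {morph fl_scale^~ x : a b / a + b}.
Proof.
move=> a b; rewrite -[x]reprK [RHS]/GRing.add /= !flE.
exact/free_lie_eq/lc_scaleDl.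
Qed.

HB.instance Definition _ := GRing.Zmodule_isLmodule.Build K free_lie
  fl_scaleA fl_scale1 fl_scaleDr fl_scaleDl.

Fact fl_brDl x y z : fl_br (x + y) z = fl_br x z + fl_br y z.
Proof.
rewrite -[x]reprK -[y]reprK -[z]reprK /GRing.add /= !flE.
exact/free_lie_eq/lc_brDl.
Qed.
Fact fl_brZl a x y : fl_br (a *: x) y = a *: fl_br x y.
Proof.
rewrite -[x]reprK -[y]reprK /GRing.scale /= !flE.
exact/free_lie_eq/lc_brZl.
Qed.
Fact fl_brDr x y z : fl_br x (y + z) = fl_br x y + fl_br x z.
Proof.
rewrite -[x]reprK -[y]reprK -[z]reprK /GRing.add /= !flE.
exact/free_lie_eq/lc_brDr.
Qed.
Fact fl_brZr a x y : fl_br x (a *: y) = a *: fl_br x y.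
Proof.
rewrite -[x]reprK -[y]reprK /GRing.scale /= !flE.
exact/free_lie_eq/lc_brZr.
Qed.
Fact fl_brxx x : fl_br x x = 0.
Proof. by rewrite -[x]reprK !flE; apply/free_lie_eq/lc_brxx. Qed.
Fact fl_jacobi x y z :
  fl_br x (fl_br y z) + fl_br y (fl_br z x) + fl_br z (fl_br x y) = 0.
Proof.
rewrite -[x]reprK -[y]reprK -[z]reprK /GRing.add /= !flE.
exact/free_lie_eq/lc_jacobi.
Qed.

HB.instance Definition _ := Lmodule_isLie.Build K free_lie
  fl_brDl fl_brZl fl_brDr fl_brZr fl_brxx fl_jacobi.

Lemma free_lieD s t : cls (LAdd s t) = (cls s : free_lie) + cls t.
Proof. exact/esym/fl_addE. Qed.
Lemma free_lieZ a s : cls (LScale a s) = a *: (cls s : free_lie).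
Proof. exact/esym/fl_scaleE. Qed.
Lemma free_lieBr s t : cls (LBr s t) = ⟦(cls s : free_lie), cls t⟧.
Proof. exact/esym/fl_brE. Qed.

Lemma free_lie_universal (L : lieAlgType K) (g : 'I_m -> L) :
  exists! f : free_lie -> L, is_lie_hom f /\ forall i, f (fl_gen i) = g i.
Proof.
pose fix ev (s : lie_term) : L := match s with
  | LVar i => g i | LZero => 0 | LAdd s t => ev s + ev t
  | LScale a s => a *: ev s | LBr s t => ⟦ev s, ev t⟧ end.
have evP s t : lie_cong s t -> ev s = ev t.
  elim=> //=.
  - by move=> ? ? ? _ -> _ ->.
  - by move=> ? ? ? ? _ -> _ ->.
  - by move=> ? ? ? _ ->.
  - by move=> ? ? ? ? _ -> _ ->.
  - by move=> *; rewrite addrA.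
  - by move=> *; rewrite addrC.
  - by move=> *; rewrite add0r.
  - by move=> *; rewrite scaleN1r addNr.
  - by move=> *; rewrite scalerA.
  - by move=> *; rewrite scale1r.
  - by move=> *; rewrite scalerDr.
  - by move=> *; rewrite scalerDl.
  - by move=> *; rewrite liebDl.
  - by move=> *; rewrite liebZl.
  - by move=> *; rewrite liebDr.
  - by move=> *; rewrite liebZr.
  - by move=> *; rewrite liebxx.
  - by move=> *; rewrite lieb_jacobi.
exists (fun x => ev (repr x)); split=> [|f [[flin fbr] fgen]].
  split; last by move=> i; apply: (evP _ _ (free_lie_repr _)).
  split=> [a x y|x y]; rewrite -[LHS]/(ev (repr _)).
    have -> : a *: x + y = cls (LAdd (LScale a (repr x)) (repr y)).
      by rewrite free_lieD free_lieZ !reprK.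
    exact: (evP _ _ (free_lie_repr _)).
  have -> : ⟦x, y⟧ = cls (LBr (repr x) (repr y)) by rewrite free_lieBr !reprK.
  exact: (evP _ _ (free_lie_repr _)).
have f0 : f 0 = 0.
  by have := flin (-1) 0 0; rewrite scaler0 addr0 scaleN1r addNr.
apply/funext => x; rewrite -{2}[x]reprK; elim: (repr x) => /=.
- by move=> i; rewrite -fgen.
- by rewrite -[LHS]f0.
- by move=> s -> t ->; rewrite free_lieD -[X in f (X + _)]scale1r flin scale1r.
- by move=> a s ->; rewrite free_lieZ -[X in _ = f X]addr0 flin f0 addr0.
- by move=> s -> t ->; rewrite free_lieBr fbr.
Qed.

End FreeLie.

Section Metabelian.
Variable L : lieAlgType K.
Local Notation D2 := (@derived2 L).

Definition metab_rel (x y : L) : bool := `[< D2 (x - y) >].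

Fact metab_refl : reflexive metab_rel.
Proof. by move=> x; apply/asboolP; rewrite subrr; left. Qed.
Fact metab_sym : symmetric metab_rel.
Proof.
by move=> x y; apply/asboolP/asboolP => /lspanN; rewrite opprB.
Qed.
Fact metab_trans : transitive metab_rel.
Proof.
move=> y x z /asboolP xy /asboolP yz; apply/asboolP.
by have := lspanD xy yz; rewrite addrA subrK.
Qed.

Canonical metab_equiv := EquivRel metab_rel metab_refl metab_sym metab_trans.

Definition metab := {eq_quot metab_rel}%qT.
HB.instance Definition _ := Choice.on metab.
HB.instance Definition _ := EqQuotient.on metab.

Local Notation cls := (\pi_metab)%qT.

Lemma metab_eqP x y : reflect (D2 (x - y)) (cls x == cls y).
Proof. by rewrite eqmodE; apply: asboolP. Qed.

Lemma metab_repr x : D2 (repr (cls x) - x).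
Proof. by apply/metab_eqP; rewrite reprK. Qed.

Definition mb_add := lift_op2 metab +%R.
Definition mb_opp := lift_op1 metab -%R.
Definition mb_scale a := lift_op1 metab ( *:%R a).
Definition mb_br := lift_op2 metab (@lieb K L).

Lemma mb_addE x y : mb_add (cls x) (cls y) = cls (x + y).
Proof.
unlock mb_add; apply/eqP/metab_eqP; rewrite opprD addrACA.
by apply: lspanD; apply: metab_repr.
Qed.
Lemma mb_oppE x : mb_opp (cls x) = cls (- x).
Proof.
unlock mb_opp; apply/eqP/metab_eqP; rewrite -opprD.
exact/lspanN/metab_repr.
Qed.
Lemma mb_scaleE a x : mb_scale a (cls x) = cls (a *: x).
Proof.
unlock mb_scale; apply/eqP/metab_eqP; rewrite -scalerBr.
exact/lspanZ/metab_repr.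
Qed.
Lemma mb_brE x y : mb_br (cls x) (cls y) = cls ⟦x, y⟧.
Proof.
unlock mb_br; apply/eqP/metab_eqP.
set a := repr _; set b := repr _.
have -> : ⟦a, b⟧ - ⟦x, y⟧ = ⟦a - x, b⟧ + ⟦x, b - y⟧.
  by rewrite liebDl liebDr liebNl liebNr addrA subrK.
apply: lspanD; first exact/derived2_ideal/metab_repr.
by rewrite liebC; apply/lspanN/derived2_ideal/metab_repr.
Qed.
Definition mbE := (mb_addE, mb_oppE, mb_scaleE, mb_brE).

Fact mb_addA : associative mb_add.
Proof.
by move=> x y z; rewrite -[x]reprK -[y]reprK -[z]reprK !mbE addrA.
Qed.
Fact mb_addC : commutative mb_add.
Proof. by move=> x y; rewrite -[x]reprK -[y]reprK !mbE addrC. Qed.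
Fact mb_add0 : left_id (cls 0) mb_add.
Proof. by move=> x; rewrite -[x]reprK !mbE add0r. Qed.
Fact mb_addN : left_inverse (cls 0) mb_opp mb_add.
Proof. by move=> x; rewrite -[x]reprK !mbE addNr. Qed.

HB.instance Definition _ := GRing.isZmodule.Build metab
  mb_addA mb_addC mb_add0 mb_addN.

Fact mb_scaleA a b x : mb_scale a (mb_scale b x) = mb_scale (a * b) x.
Proof. by rewrite -[x]reprK !mbE scalerA. Qed.
Fact mb_scale1 : left_id 1 mb_scale.
Proof. by move=> x; rewrite -[x]reprK !mbE scale1r. Qed.
Fact mb_scaleDr : right_distributive mb_scale +%R.
Proof.
by move=> a x y; rewrite -[x]reprK -[y]reprK /GRing.add /= !mbE scalerDr.
Qed.
Fact mb_scaleDl x : {morph mb_scale^~ x : a b / a + b}.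
Proof.
by move=> a b; rewrite -[x]reprK [RHS]/GRing.add /= !mbE scalerDl.
Qed.

HB.instance Definition _ := GRing.Zmodule_isLmodule.Build K metab
  mb_scaleA mb_scale1 mb_scaleDr mb_scaleDl.

Fact mb_brDl x y z : mb_br (x + y) z = mb_br x z + mb_br y z.
Proof.
by rewrite -[x]reprK -[y]reprK -[z]reprK /GRing.add /= !mbE liebDl.
Qed.
Fact mb_brZl a x y : mb_br (a *: x) y = a *: mb_br x y.
Proof. by rewrite -[x]reprK -[y]reprK /GRing.scale /= !mbE liebZl. Qed.
Fact mb_brDr x y z : mb_br x (y + z) = mb_br x y + mb_br x z.
Proof.
by rewrite -[x]reprK -[y]reprK -[z]reprK /GRing.add /= !mbE liebDr.
Qed.
Fact mb_brZr a x y : mb_br x (a *: y) = a *: mb_br x y.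
Proof. by rewrite -[x]reprK -[y]reprK /GRing.scale /= !mbE liebZr. Qed.
Fact mb_brxx x : mb_br x x = 0.
Proof. by rewrite -[x]reprK !mbE liebxx. Qed.
Fact mb_jacobi x y z :
  mb_br x (mb_br y z) + mb_br y (mb_br z x) + mb_br z (mb_br x y) = 0.
Proof.
by rewrite -[x]reprK -[y]reprK -[z]reprK /GRing.add /= !mbE lieb_jacobi.
Qed.

HB.instance Definition _ := Lmodule_isLie.Build K metab
  mb_brDl mb_brZl mb_brDr mb_brZr mb_brxx mb_jacobi.

End Metabelian.

End LieTheory.

Section Completion.
Variables (K : fieldType) (m : nat).

Definition free_metab := metab (free_lie K m).
HB.instance Definition _ := LieAlgebra.on free_metab.

Definition fm_gen (i : 'I_m) : free_metab := (\pi_free_metab (fl_gen K i))%qT.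

Inductive lie_monomial : nat -> free_metab -> Prop :=
| lm_gen i : lie_monomial 1 (fm_gen i)
| lm_br j k x y of lie_monomial j x & lie_monomial k y :
    lie_monomial (j + k) ⟦x, y⟧.

(* The homogeneous component of degree [k]; it is [0] for [k = 0]. *)
Definition homog (k : nat) : set free_metab := lspan (lie_monomial k).

Lemma homog_br j k x y : homog j x -> homog k y -> homog (j + k) ⟦x, y⟧.
Proof.
elim=> [|a s t ms _ IH] hy; first by rewrite lie0b; left.
rewrite liebDl liebZl; apply: lspanD (IH hy); apply: lspanZ.
elim: hy => [|b z v mz _ IHv]; first by rewrite lieb0; left.
rewrite liebDr liebZr; apply: lspanD => //; apply/lspanZ/lspan_sub.
exact: lm_br.
Qed.

Lemma homog0 x : homog 0 x -> x = 0.
Proof.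
have mono k y : lie_monomial k y -> (0 < k)%N.
  by elim=> // j l ? ? _ j0 _ _; rewrite addn_gt0 j0.
by elim=> // a y z /mono.
Qed.

(* The formal infinite sums f_1 + f_2 + ... with f_k homogeneous of degree k;
   the component f_0 is then automatically 0. *)
Definition hat_pred (f : nat -> free_metab) : bool :=
  `[< forall k, homog k (f k) >].

Record fm_hat := Hat { comp :> nat -> free_metab; _ : hat_pred comp }.
HB.instance Definition _ := [isSub for comp].
HB.instance Definition _ := gen_eqMixin fm_hat.
HB.instance Definition _ := gen_choiceMixin fm_hat.

Definition mkHat (f : nat -> free_metab) (fP : forall k, homog k (f k)) : fm_hat :=
  Hat (asboolT fP).

Lemma hat_homog (f : fm_hat) k : homog k (f k).
Proof. by case: f => f /= /asboolP. Qed.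

Lemma hat_comp0 (f : fm_hat) : f 0 = 0.
Proof. exact/homog0/hat_homog. Qed.

Lemma hatP (f g : fm_hat) : f =1 g -> f = g.
Proof. by move=> fg; apply/val_inj/funext. Qed.

Fact hat_add_subproof (f g : fm_hat) k : homog k (f k + g k).
Proof. by apply: lspanD; apply: hat_homog. Qed.
Fact hat_scale_subproof a (f : fm_hat) k : homog k (a *: f k).
Proof. by apply: lspanZ; apply: hat_homog. Qed.
Fact hat_zero_subproof k : homog k 0. Proof. exact: lspan0. Qed.
Fact hat_br_subproof (f g : fm_hat) n :
  homog n (\sum_(i < n.+1) ⟦f i, g (n - i)%N⟧).
Proof.
apply: lspan_sum => i _; rewrite -{1}(subnKC (_ : i <= n)%N) -1?ltnS //.
by apply: homog_br; apply: hat_homog.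
Qed.

Definition hat_add f g := mkHat (hat_add_subproof f g).
Definition hat_scale a f := mkHat (hat_scale_subproof a f).
Definition hat_zero := mkHat hat_zero_subproof.
Definition hat_br f g := mkHat (hat_br_subproof f g).

Fact hat_addA : associative hat_add.
Proof. by move=> f g h; apply: hatP => n /=; rewrite addrA. Qed.
Fact hat_addC : commutative hat_add.
Proof. by move=> f g; apply: hatP => n /=; rewrite addrC. Qed.
Fact hat_add0 : left_id hat_zero hat_add.
Proof. by move=> f; apply: hatP => n /=; rewrite add0r. Qed.
Fact hat_addN : left_inverse hat_zero (hat_scale (-1)) hat_add.
Proof. by move=> f; apply: hatP => n /=; rewrite scaleN1r addNr. Qed.

HB.instance Definition _ := GRing.isZmodule.Build fm_hat
  hat_addA hat_addC hat_add0 hat_addN.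

Fact hat_scaleA a b f : hat_scale a (hat_scale b f) = hat_scale (a * b) f.
Proof. by apply: hatP => n /=; rewrite scalerA. Qed.
Fact hat_scale1 : left_id 1 hat_scale.
Proof. by move=> f; apply: hatP => n /=; rewrite scale1r. Qed.
Fact hat_scaleDr : right_distributive hat_scale +%R.
Proof. by move=> a f g; apply: hatP => n /=; rewrite scalerDr. Qed.
Fact hat_scaleDl f : {morph hat_scale^~ f : a b / a + b}.
Proof. by move=> a b; apply: hatP => n /=; rewrite scalerDl. Qed.

HB.instance Definition _ := GRing.Zmodule_isLmodule.Build K fm_hat
  hat_scaleA hat_scale1 hat_scaleDr hat_scaleDl.

Fact hat_brDl f g h : hat_br (f + g) h = hat_br f h + hat_br g h.
Proof.
apply: hatP => n /=; rewrite -big_split /=.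
by apply: eq_bigr => i _; rewrite liebDl.
Qed.
Fact hat_brZl a f g : hat_br (a *: f) g = a *: hat_br f g.
Proof.
apply: hatP => n /=; rewrite scaler_sumr.
by apply: eq_bigr => i _; rewrite liebZl.
Qed.
Fact hat_brDr f g h : hat_br f (g + h) = hat_br f g + hat_br f h.
Proof.
apply: hatP => n /=; rewrite -big_split /=.
by apply: eq_bigr => i _; rewrite liebDr.
Qed.
Fact hat_brZr a f g : hat_br f (a *: g) = a *: hat_br f g.
Proof.
apply: hatP => n /=; rewrite scaler_sumr.
by apply: eq_bigr => i _; rewrite liebZr.
Qed.
Fact hat_brxx f : hat_br f f = 0.
Proof.
apply: hatP => n /=.
rewrite (bigID (fun i : 'I_n.+1 => (i < n - i)%N)) /=.
rewrite [X in _ + X](bigID (fun i : 'I_n.+1 => (n - i < i)%N)) /=.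
rewrite [X in _ + (_ + X)]big1 ?addr0; last first.
  move=> i /andP[]; rewrite -!leqNgt => i1 i2.
  have /eqP -> : (n - i == i)%N by rewrite eqn_leq i1 i2.
  exact: liebxx.
rewrite [X in _ + X](reindex_inj rev_ord_inj) /= -[RHS](addrN
  (\sum_(i < n.+1 | (i < n - i)%N) ⟦f i, f (n - i)%N⟧)); congr (_ + _).
rewrite -sumrN; apply: eq_big => [i|i _].
  by rewrite subSS subKn -1?ltnS // -leqNgt andb_idl // => /ltnW.
by rewrite subSS subKn -1?ltnS // liebC.
Qed.
Fact hat_jacobi f g h :
  hat_br f (hat_br g h) + hat_br g (hat_br h f) + hat_br h (hat_br f g) = 0.
Proof.
apply: hatP => n /=.
have H (a b c : fm_hat) : \sum_(i < n.+1) ⟦a i, hat_br b c (n - i)%N⟧ =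
    \sum_(i < n.+1) \sum_(j < (n - i).+1) ⟦a i, ⟦b j, c (n - i - j)%N⟧⟧.
  by apply: eq_bigr => i _; rewrite lieb_sumr.
rewrite !H (conv_cycle n (fun i j k => ⟦g i, ⟦h j, f k⟧⟧)).
rewrite (conv_cycle n (fun i j k => ⟦h i, ⟦f j, g k⟧⟧)).
rewrite (conv_cycle n (fun i j k => ⟦h j, ⟦f k, g i⟧⟧)) -!big_split /=.
rewrite big1 // => i _; rewrite -!big_split /= big1 // => j _.
exact: lieb_jacobi.
Qed.

HB.instance Definition _ := Lmodule_isLie.Build K fm_hat
  hat_brDl hat_brZl hat_brDr hat_brZr hat_brxx hat_jacobi.

Lemma hat_compD (f g : fm_hat) n : (f + g) n = f n + g n.
Proof. by []. Qed.
Lemma hat_compZ a (f : fm_hat) n : (a *: f) n = a *: f n.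
Proof. by []. Qed.
Lemma hat_comp_br (f g : fm_hat) n :
  ⟦f, g⟧ n = \sum_(i < n.+1) ⟦f i, g (n - i)%N⟧.
Proof. by []. Qed.
Lemma hat_comp_sum I (r : seq I) (P : pred I) (F : I -> fm_hat) n :
  (\sum_(i <- r | P i) F i) n = \sum_(i <- r | P i) F i n.
Proof. by elim/big_rec2: _ => [//|i x y _ <-]. Qed.

Definition hat_linear (f : fm_hat) : Prop := forall k, k != 1 -> f k = 0.

Fact hat_single_subproof d (x : free_metab) (dx : homog d x) k :
  homog k (if k == d then x else 0).
Proof. by case: eqP => [->|_] //; left. Qed.
Definition hat_single d x (dx : homog d x) : fm_hat :=
  mkHat (hat_single_subproof dx).

Lemma homog_ad_gen k x : homog k.+2 x ->
  exists2 g : 'I_m -> free_metab, forall i, homog k.+1 (g i) &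
    x = \sum_i ⟦g i, fm_gen i⟧.
Proof.
pose Q k x := exists2 g : 'I_m -> free_metab, forall i, homog k (g i) &
    x = \sum_i ⟦g i, fm_gen i⟧.
have Q0 l : Q l 0.
  exists (fun=> 0) => [i|]; first exact: lspan0.
  by rewrite big1 // => i _; rewrite lie0b.
have QD l a y z : Q l y -> Q l z -> Q l (a *: y + z).
  move=> [g gh ->] [g' gh' ->]; exists (fun i => a *: g i + g' i) => [i|].
    by apply: lspanD; [apply/lspanZ/gh | apply: gh'].
  rewrite scaler_sumr -big_split /=; apply: eq_bigr => i _.
  by rewrite liebDl liebZl.
have QB l y : lie_monomial l y ->
    forall j z, homog j z -> Q (j + l).-1 ⟦z, y⟧.
  elim=> {l y} [i|l l' y y' my IHy my' IHy'] j z hz.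
    exists (fun i' => if i' == i then z else 0) => [i'|].
      by rewrite addn1 /=; case: eqP => // _; left.
    rewrite (bigD1 i) //= eqxx big1 ?addr0 // => i' /negPf ->.
    exact: lie0b.
  have -> : ⟦z, ⟦y, y'⟧⟧ = -1 *: ⟦⟦z, y'⟧, y⟧ + ⟦⟦z, y⟧, y'⟧.
    rewrite scaleN1r -liebC [⟦z, y'⟧]liebC liebNr [⟦⟦z, y⟧, y'⟧]liebC.
    rewrite -opprD; apply/eqP; rewrite -addr_eq0 addrA; apply/eqP.
    exact: lieb_jacobi.
  apply: QD; last by rewrite addnA; apply: IHy' => //;
    apply: homog_br => //; apply: lspan_sub.
  rewrite [(l + l')%N]addnC addnA.
  by apply: IHy => //; apply: homog_br => //; apply: lspan_sub.
elim=> [|a y z my _ IH]; first exact: Q0.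
apply: QD IH; have QM l w : lie_monomial l w -> l = k.+2 -> Q k.+1 w.
  case=> // j l' p q mp mq E.
  by have := QB _ _ mq _ _ (lspan_sub mp); rewrite E.
exact: QM my _.
Qed.

(* The commutator ideal of the completion consists of the series with zero
   linear component. *)
Lemma hat_derived1P (f : fm_hat) : derived1 f <-> f 1 = 0.
Proof.
split=> [|f1].
  elim=> // a x y [g [h [_ _ ->]]] _ IH.
  rewrite hat_compD hat_compZ IH addr0 hat_comp_br big_ord_recl big_ord1 /=.
  by rewrite !hat_comp0 lie0b lieb0 addr0 scaler0.
have /choice[g gP] k : exists g : 'I_m -> free_metab,
    (forall i, homog k (g i)) /\ f k.+1 = \sum_i ⟦g i, fm_gen i⟧.
  case: k => [|k]; last first.
    by have [g gh fE] := homog_ad_gen (hat_homog f k.+2); exists g.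
  exists (fun=> 0); split=> [i|]; first exact: lspan0.
  by rewrite f1 big1 // => i _; rewrite lie0b.
pose G i := mkHat (fun k => (gP k).1 i).
have -> : f = \sum_i ⟦G i, hat_single (lspan_sub (lm_gen i))⟧.
  apply: hatP => -[|n].
    by rewrite hat_comp0 hat_comp0.
  rewrite (gP n).2 hat_comp_sum; apply: eq_bigr => i _.
  rewrite hat_comp_br big_ord_recr /= subnn lieb0 addr0.
  rewrite big_ord_recr /= subSnn eqxx big1 ?add0r // => j _.
  case: eqP => [|_]; last exact: lieb0.
  by have := ltn_ord j; lia.
by apply: lspan_sum => i _; apply: derived1_br.
Qed.

(* Convergence in the formal power series topology, where [f] and [g] are close
   when they agree in all degrees below a large bound. *)
Definition hat_cvg (s : nat -> fm_hat) (f : fm_hat) : Prop :=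
  forall n, exists N, forall M, (N <= M)%N -> s M n = f n.

Fact hat_sum_subproof (a : nat -> fm_hat) n :
  homog n (\sum_(k < n.+1) a k n).
Proof. by apply: lspan_sum => k _; apply: hat_homog. Qed.
(* The sum of a series whose k-th term vanishes in all degrees below k, so that
   only finitely many terms contribute in each degree. *)
Definition hat_sum (a : nat -> fm_hat) : fm_hat := mkHat (hat_sum_subproof a).

Lemma hat_sum_cvg (a : nat -> fm_hat) :
  (forall k n, (n < k)%N -> a k n = 0) ->
  hat_cvg (fun M => \sum_(k < M) a k) (hat_sum a).
Proof.
move=> a0 n; exists n.+1 => M nM; rewrite hat_comp_sum /=.
rewrite [RHS](big_ord_widen M (fun k => a k n)) // [LHS](bigID (fun k : 'I_M =>
  (k < n.+1)%N)) /= [X in _ + X]big1 ?addr0 // => k.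
by rewrite -leqNgt => /a0.
Qed.

(* Operators act on the right: x (ad u) = [x, u]. *)
Definition adr (u x : fm_hat) : fm_hat := ⟦x, u⟧.

Lemma adr_order (u x : fm_hat) k : (forall n, (n < k)%N -> x n = 0) ->
  forall n, (n < k.+1)%N -> adr u x n = 0.
Proof.
move=> x0 n nk; rewrite hat_comp_br big1 // => i _.
have [ik|ki] := ltnP i k; first by rewrite x0 // lie0b.
rewrite (_ : n - i = 0)%N ?hat_comp0 ?lieb0 //; have := ltn_ord i; lia.
Qed.

Lemma iter_adr_order (u x : fm_hat) j k : (forall n, (n < k)%N -> x n = 0) ->
  forall n, (n < j + k)%N -> iter j (adr u) x n = 0.
Proof. by move=> x0; elim: j => //= j IH n nj; apply: adr_order nj. Qed.

Definition exp_term (u x : fm_hat) (k : nat) : fm_hat :=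
  (k`!%:R^-1 : K) *: iter k (adr u) x.

Definition exp_ad (u x : fm_hat) : fm_hat := hat_sum (exp_term u x).

Lemma exp_ad_cvg u x :
  hat_cvg (fun M => \sum_(k < M) exp_term u x k) (exp_ad u x).
Proof.
apply: hat_sum_cvg => k n nk.
by rewrite hat_compZ (@iter_adr_order u x k 0) ?addn0 // scaler0.
Qed.

End Completion.

(* K[[t1, t2]] is realized as K[[t1]][[t2]]. *)
Notation fps2 K := (fps (fps K)).

Section Bivariate.
Variable K : fieldType.
Local Notation fps2 := (fps2 K).

Definition t1 : fps2 := fpsC (fpsX K).
Definition t2 : fps2 := fpsX (fps K).
(* The coefficient of t1^i t2^j. *)
Definition coef2 (p : fps2) (i j : nat) : K := coefs (coefs p j) i.

Lemma fps2P (p q : fps2) : coef2 p =2 coef2 q -> p = q.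
Proof. by move=> pq; apply: fpsP => j; apply: fpsP => i; apply: pq. Qed.

(* The substitution p(s), for s without constant term: s^n then has no
   monomials of degree less than n. *)
Definition fps_subst (p : fps K) (s : fps2) : fps2 :=
  Fps (fun j => Fps (fun i =>
    \sum_(n < (i + j).+1) coefs p n * coef2 (s ^+ n) i j)).

Definition fps_exp : fps K := Fps (fun n => n`!%:R^-1).

Definition h_series : fps K := fps_div (fps_exp - 1) (fpsX K).

(* Numerator and denominator share the non-invertible factor t1 + t2, so [c] is
   the exact quotient in K[[t1, t2]]; see [c_seriesP] and [c_series_uniq]. *)
Definition c_num : fps2 :=
  fps_subst fps_exp t2 * fps_subst h_series t1 - fps_subst h_series t2.
Definition c_den : fps2 := fps_subst fps_exp (t1 + t2) - 1.
Definition c_series : fps2 := fps_div c_num c_den.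

Lemma coef2D (p q : fps2) i j : coef2 (p + q) i j = coef2 p i j + coef2 q i j.
Proof. by []. Qed.
Lemma coef2B (p q : fps2) i j : coef2 (p - q) i j = coef2 p i j - coef2 q i j.
Proof. by []. Qed.
Lemma coef2_1 i j : coef2 1 i j = ((i == 0) && (j == 0))%:R.
Proof.
rewrite /coef2 coef_fps1; case: (j == 0); rewrite ?andbT ?andbF.
  exact: coef_fps1.
exact: coef_fps0.
Qed.

Lemma coef2_t1M (p : fps2) i j :
  coef2 (t1 * p) i j = if i is i'.+1 then coef2 p i' j else 0.
Proof.
by rewrite /coef2 coef_fpsCM coef_fpsXM. Qed.

Lemma coef2_t2M (p : fps2) i j :
  coef2 (t2 * p) i j = if j is j'.+1 then coef2 p i j' else 0.
Proof.
by rewrite /coef2 coef_fpsXM; case: j => // ; rewrite coef_fps0. Qed.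

Lemma coef2_t1X n i j : coef2 (t1 ^+ n) i j = ((i == n) && (j == 0))%:R.
Proof.
elim: n i => [|n IH] i; first by rewrite expr0 coef2_1.
by rewrite exprS coef2_t1M; case: i => // i; rewrite IH.
Qed.

Lemma coef2_t2X n i j : coef2 (t2 ^+ n) i j = ((i == 0) && (j == n))%:R.
Proof.
elim: n j => [|n IH] j; first by rewrite expr0 coef2_1.
by rewrite exprS coef2_t2M; case: j => [|j]; rewrite ?IH // andbF.
Qed.

Lemma coef2_tDX n i j :
  coef2 ((t1 + t2) ^+ n) i j = if (i + j == n)%N then 'C(n, i)%:R else 0.
Proof.
elim: n i j => [|n IH] i j.
  by rewrite expr0 coef2_1 addn_eq0; case: i => [|i] //; case: j.
rewrite exprS mulrDl coef2D coef2_t1M coef2_t2M.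
case: i j => [|i] [|j]; rewrite ?IH ?addr0 ?add0r ?addn0 ?add0n //.
- by rewrite eqSS !bin0.
- by rewrite eqSS; case: eqP => // ->; rewrite !binn.
rewrite !addSn !addnS eqSS; case: ((i + j).+1 == n); rewrite ?addr0 //.
by rewrite -natrD addnC -binS.
Qed.

Lemma coef2_subst_t1 p i j :
  coef2 (fps_subst p t1) i j = if j == 0 then coefs p i else 0.
Proof.
rewrite {1}/coef2 /=; under eq_bigr do rewrite coef2_t1X.
case: eqP => [->|_]; last by rewrite big1 // => k _; rewrite andbF mulr0.
rewrite addn0 big_ord_recr /= eqxx mulr1 big1 ?add0r // => k _.
by rewrite gtn_eqF ?mulr0.
Qed.

Lemma coef2_subst_t2 p i j :
  coef2 (fps_subst p t2) i j = if i == 0 then coefs p j else 0.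
Proof.
rewrite {1}/coef2 /=; under eq_bigr do rewrite coef2_t2X.
case: eqP => [->|_]; last by rewrite big1 // => k _; rewrite mulr0.
rewrite add0n big_ord_recr /= eqxx mulr1 big1 ?add0r // => k _.
by rewrite gtn_eqF ?mulr0.
Qed.

Lemma coef2_subst_tD p i j :
  coef2 (fps_subst p (t1 + t2)) i j = coefs p (i + j) * 'C(i + j, i)%:R.
Proof.
rewrite {1}/coef2 /=; under eq_bigr do rewrite coef2_tDX.
rewrite big_ord_recr /= eqxx big1 ?add0r // => k _.
by rewrite gtn_eqF ?mulr0.
Qed.

Lemma h_seriesP : h_series * fpsX K = fps_exp - 1.
Proof.
apply: fps_divP; exists (Fps (fun n => n.+1`!%:R^-1)).
apply: fpsP => -[|n]; rewrite mulrC coef_fpsXM coef_fpsD coef_fpsN coef_fps1.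
  by rewrite /= fact0 invr1 subrr.
by rewrite subr0.
Qed.

Lemma coef_h n : coefs h_series n = n.+1`!%:R^-1.
Proof.
have := congr1 (fun p => coefs p n.+1) h_seriesP.
by rewrite mulrC coef_fpsXM coef_fpsD coef_fpsN coef_fps1 subr0.
Qed.

Lemma coef2_exp_t2M p i j :
  coef2 (fps_subst fps_exp t2 * p) i j =
  \sum_(k < j.+1) k`!%:R^-1 * coef2 p i (j - k).
Proof.
rewrite /coef2 coef_fpsM coef_fps_sum; apply: eq_bigr => k _.
have -> : coefs (fps_subst fps_exp t2) k = fpsC k`!%:R^-1.
  by apply: fpsP => l; apply: coef2_subst_t2.
by rewrite coef_fpsCM.
Qed.

Lemma coef2_c_num i j : coef2 c_num i j =
  (j`!%:R * i.+1`!%:R)^-1 - (if i == 0 then j.+1`!%:R^-1 else 0).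
Proof.
rewrite coef2B coef2_exp_t2M; congr (_ - _); last first.
  by have := coef2_subst_t2 h_series i j; rewrite coef_h.
under eq_bigr => k _ do
  (have -> := coef2_subst_t1 h_series i (j - k); rewrite coef_h).
rewrite big_ord_recr /= subnn invfM big1 ?add0r // => k _.
by rewrite subn_eq0 leqNgt ltn_ord mulr0.
Qed.

Section CharZero.
Hypothesis charK : [pchar K] =i pred0.

Lemma char0_neq0 n : (n.+1%:R : K) != 0.
Proof. by have /pcharf0P -> := charK. Qed.

Lemma char0_fact n : (n`!%:R : K) != 0.
Proof. by case: (n`!) (fact_gt0 n) => // k _; apply: char0_neq0. Qed.

Lemma coef2_c_den i j : coef2 c_den i j =
  (i`!%:R * j`!%:R)^-1 - ((i == 0) && (j == 0))%:R.
Proof.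
rewrite coef2B coef2_1 coef2_subst_tD /=; congr (_ - _).
have := bin_fact (leq_addr j i); rewrite addKn => <-.
rewrite !natrM (invfM 'C(i + j, i)%:R) mulrAC mulVf ?mul1r //.
case: 'C(_, _) (bin_gt0 (i + j) i) => [|k _]; first by rewrite leq_addr.
exact: char0_neq0.
Qed.

Lemma c_num_factor : exists N, c_num = (t1 + t2) * N.
Proof.
exists (Fps (fun j => Fps (fun i =>
  (i.+1`!%:R * j`!%:R * (i + j).+2%:R)^-1))).
apply: fps2P => i j.
rewrite coef2_c_num mulrDl coef2D coef2_t1M coef2_t2M /coef2 /=.
have F n : (n.+1`!%:R : K) = n.+1%:R * n`!%:R by rewrite factS natrM.
have nz := char0_neq0; have fz := char0_fact.
have split_inv (A B p q : K) : A != 0 -> B != 0 -> p != 0 -> q != 0 ->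
    p + q != 0 ->
    (q * B * (p * A))^-1 = (A * (q * B) * (p + q))^-1 + (p * A * B * (p + q))^-1.
  by move=> *; field; do ?[apply/andP; split].
have telescope (B p : K) : B != 0 -> p != 0 -> p + 1 != 0 ->
    (p * B * 1)^-1 - ((p + 1) * (p * B))^-1 = (1 * B * (p + 1))^-1.
  by move=> *; field; do ?[apply/andP; split].
case: i j => [|i] [|j] /=; rewrite ?subr0 ?add0r ?addr0.
- by rewrite fact0 !mulr1 invr1 subrr.
- rewrite [j.+2`!%:R]F [j.+1`!%:R]F (_ : 1`! = 1)%N // add0n.
  rewrite (_ : j.+2%:R = j.+1%:R + 1 :> K) ?natr1 //.
  have := nz j.+1; rewrite -(natr1 j.+1) => nzj.
  by apply: telescope; rewrite // natr1.
- by rewrite fact0 mul1r mulr1 addn0 [i.+2`!%:R]F mulrC.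
rewrite [i.+2`!%:R]F [j.+1`!%:R]F !addSn !addnS.
have E : (i + j).+3%:R = i.+2%:R + j.+1%:R :> K.
  by rewrite -natrD !addSn addnS.
by rewrite E; apply: split_inv; rewrite // -E.
Qed.

Lemma c_den_factor : exists G G', G' * G = 1 /\ c_den = (t1 + t2) * G.
Proof.
have nz := char0_neq0; have fz := char0_fact.
pose G := fps_subst h_series (t1 + t2).
have [q0 q0P] : exists q0, q0 * coefs G 0 = 1.
  apply: (@fps_inv_exists _ _ 1); rewrite mul1r.
  by rewrite -[LHS]/(coef2 G 0 0) coef2_subst_tD coef_h mulr1 invr1.
have [G' G'P] := fps_inv_exists q0P.
exists G, G'; split=> //; apply: fps2P => i j.
rewrite coef2_c_den mulrDl coef2D coef2_t1M coef2_t2M.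
have binE a b : ('C(a + b, a)%:R : K) = (a + b)`!%:R / (a`!%:R * b`!%:R).
  have := bin_fact (leq_addr b a); rewrite addKn => <-.
  by rewrite !natrM mulfK // mulf_neq0.
have F n : (n.+1`!%:R : K) = n.+1%:R * n`!%:R by rewrite factS natrM.
have GE a b : coef2 G a b = ((a + b).+1%:R * a`!%:R * b`!%:R)^-1.
  rewrite coef2_subst_tD coef_h binE F.
  have cancel_fact (n f x y : K) : n != 0 -> f != 0 -> x != 0 -> y != 0 ->
      (n * f)^-1 * (f / (x * y)) = (n * x * y)^-1.
    by move=> *; field; do ?[apply/andP; split].
  exact: cancel_fact.
have split_inv (A B p q : K) : A != 0 -> B != 0 -> p != 0 -> q != 0 ->
    p + q != 0 ->
    (p * A * (q * B))^-1 = ((p + q) * A * (q * B))^-1 + ((p + q) * (p * A) * B)^-1.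
  by move=> *; field; do ?[apply/andP; split].
case: i j => [|i] [|j]; rewrite ?GE /= ?subr0 ?add0r ?addr0.
- by rewrite fact0 mulr1 invr1 subrr.
- by rewrite add0n fact0 F mulr1 mul1r.
- by rewrite addn0 fact0 F !mulr1.
rewrite !addSn !addnS !F.
have E : (i + j).+2%:R = i.+1%:R + j.+1%:R :> K by rewrite -natrD addSn addnS.
by rewrite E; apply: split_inv; rewrite // -E.
Qed.

Lemma c_seriesP : c_series * c_den = c_num.
Proof.
apply: fps_divP; have [N ->] := c_num_factor.
have [G [G' [G'G ->]]] := c_den_factor.
by exists (N * G'); rewrite mulrCA -mulrA G'G mulr1.
Qed.

Lemma c_series_uniq r : r * c_den = c_num -> r = c_series.
Proof.
rewrite -c_seriesP => /eqP; rewrite -subr_eq0 -mulrBl => /eqP rc.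
have dom (p q : fps K) : p * q = 0 -> p = 0 \/ q = 0.
  apply: fps_mulf_eq0 => a b /eqP; rewrite mulf_eq0.
  by case/orP => /eqP; [left | right].
case: (fps_mulf_eq0 dom rc) => [/subr0_eq //|].
move=> /(congr1 (fun p => coef2 p 1 0)); rewrite coef2_c_den /coef2 !coef_fps0.
by rewrite mulr1 invr1 subr0 => /eqP; rewrite oner_eq0.
Qed.

End CharZero.

End Bivariate.

Section Action.
Variables (K : fieldType) (m : nat).
Local Notation fm_hat := (fm_hat K m).

Definition act_term (p : fps2 K) (a b f : fm_hat) (i j : nat) : fm_hat :=
  coef2 p i j *: iter j (adr b) (iter i (adr a) f).

(* f p(ad a, ad b) *)
Definition ps_act (p : fps2 K) (a b f : fm_hat) : fm_hat :=
  hat_sum (fun i => hat_sum (act_term p a b f i)).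

Lemma ps_act_cvg p a b f : hat_cvg
  (fun M => \sum_(i < M) \sum_(j < M) act_term p a b f i j) (ps_act p a b f).
Proof.
have T0 i j n : (n < i + j)%N -> act_term p a b f i j n = 0.
  move=> nij; rewrite hat_compZ (@iter_adr_order _ _ _ _ j i) ?scaler0 //.
    by move=> k ki; apply: (@iter_adr_order _ _ _ _ i 0); rewrite ?addn0.
  by rewrite addnC.
move=> n; exists n.+1 => M nM; rewrite hat_comp_sum /=.
rewrite [RHS](big_ord_widen M (fun i => \sum_(j < n.+1) act_term p a b f i j n)) //.
rewrite [LHS](bigID (fun k : 'I_M => (k < n.+1)%N)) /=.
rewrite [X in _ + X]big1 ?addr0 => [|i]; last first.
  rewrite -leqNgt => ni; rewrite hat_comp_sum big1 // => j _; rewrite T0 //.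
  by rewrite ltn_addr.
apply: eq_bigr => i _; rewrite hat_comp_sum.
rewrite [RHS](big_ord_widen M (fun j => act_term p a b f i j n)) //.
rewrite [LHS](bigID (fun k : 'I_M => (k < n.+1)%N)) /=.
rewrite [X in _ + X]big1 ?addr0 // => j; rewrite -leqNgt => nj.
by apply: T0; rewrite ltn_addl.
Qed.

Definition H_lin (a b : fm_hat) : fm_hat := a + b + ps_act (c_series K) a b ⟦a, b⟧.

End Action.

(* Main.v *)
Require Import Defs.
From HB Require Import structures.
From mathcomp Require Import all_boot all_order all_algebra.
From mathcomp Require Import ring zify ssrcomplements mpoly.

(* On the commutator ideal M of the completion the operators ad commute and only
   depend on linear parts, so M is a module over K[[t1, t2]], with t1 and t2
   acting as ad u and ad v.  As x exp(ad u) = x + [x, u] h(ad u) with [x, u] in M,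
   the equation exp(ad u) exp(ad v) = exp(ad w) reduces to
     [x, w] h(t1 + t2) = [x, u] h(t1) (1 + t2 h(t2)) + [x, v] h(t2),
   and the given w solves it because
     (1 + t2 c) h(t1 + t2) = h(t1) e^t2  and  (1 - t1 c) h(t1 + t2) = h(t2).
   For uniqueness, degree 2 of exp(ad w) determines [x, w_1], and h(t1 + t2) is
   invertible, so it suffices that the free metabelian Lie algebra has trivial
   centre.  The Magnus embedding phi, sending y_i to the pair (eps_i, e_i), turns
   the bracket with y_k on the commutator ideal into multiplication by X_k on a free
   K[X_1, ..., X_m]-module, and it is injective by the Koszul homotopy. *)

Set Implicit Arguments.
Unset Strict Implicit.
Unset Printing Implicit Defensive.

Import GRing.Theory.
Local Open Scope ring_scope.

(** * The centre of the free metabelian Lie algebra *)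

Section MetabelianLie.
Variable K : fieldType.

Definition is_metabelian (L : lieAlgType K) : Prop :=
  forall a b c d : L, ⟦⟦a, b⟧, ⟦c, d⟧⟧ = 0.

Lemma metab_metabelian (L : lieAlgType K) : is_metabelian (metab L).
Proof.
move=> a b c d; rewrite -[a]reprK -[b]reprK -[c]reprK -[d]reprK.
rewrite /lieb /= !mb_brE; apply/eqP/metab_eqP; rewrite subr0.
apply: lspan_sub; do 2![eexists]; split; last by [].
  exact: derived1_br.
exact: derived1_br.
Qed.

Section Theory.
Variable L : lieAlgType K.
Hypothesis metL : is_metabelian L.

Lemma derived1_abelian (x y : L) : derived1 x -> derived1 y -> ⟦x, y⟧ = 0.
Proof.
elim=> [|a x' z [p [q [_ _ ->]]] _ IH] dy; first by rewrite lie0b.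
rewrite liebDl liebZl IH // addr0.
elim: dy => [|b y' t [r [s [_ _ ->]]] _ IHy]; first by rewrite lieb0 scaler0.
by rewrite liebDr liebZr metL scaler0 add0r.
Qed.

Lemma lieb_leibniz (x a b : L) : ⟦x, ⟦a, b⟧⟧ = ⟦⟦x, a⟧, b⟧ - ⟦⟦x, b⟧, a⟧.
Proof.
have := lieb_jacobi x a b.
rewrite (liebC a ⟦b, x⟧) (liebC b ⟦x, a⟧) (liebC b x) liebNl opprK => /eqP.
by rewrite subr_eq0 => /eqP <-; rewrite addrK.
Qed.

(** The commutator of the two operators is [ad ⟦a, b⟧], which kills the abelian derived algebra;
    hence the latter is a module over commuting variables. *)
Lemma derived1_brC (x a b : L) : derived1 x -> ⟦⟦x, a⟧, b⟧ = ⟦⟦x, b⟧, a⟧.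
Proof.
move=> dx; apply/eqP; rewrite -subr_eq0 -lieb_leibniz.
by rewrite derived1_abelian //; apply: derived1_br.
Qed.

End Theory.
(** A homomorphism to a metabelian algebra kills [derived2], so the one given by freeness of
    [free_lie] is constant on classes. *)
Lemma metab_universal m (L : lieAlgType K) (g : 'I_m -> L) : is_metabelian L ->
  exists2 f : free_metab K m -> L,
    is_lie_hom f & forall i, f (fm_gen K i) = g i.
Proof.
move=> metL; have [f [[[fl fb] fg] _]] := free_lie_universal g.
pose pi : free_lie K m -> free_metab K m := (\pi_(metab (free_lie K m)))%qT.
have f0 : f 0 = 0.
  by have := fl (-1) 0 0; rewrite scaler0 addr0 scaleN1r addNr.
have D1 x : derived1 x -> derived1 (f x).
  elim=> [|a x' y [p [q [_ _ ->]]] _ IH]; first by rewrite f0; left.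
  by rewrite fl fb; apply: lspanD IH; apply/lspanZ/derived1_br.
have D2 x : derived2 x -> f x = 0.
  elim=> [//|a x' y [p [q [dp dq ->]]] _ IH].
  by rewrite fl fb IH addr0 derived1_abelian ?scaler0 //; apply: D1.
have fE x : f (repr (pi x)) = f x.
  have /D2 := metab_repr x.
  rewrite addrC -scaleN1r fl scaleN1r => /eqP.
  by rewrite addrC subr_eq0 => /eqP.
exists (fun x => f (repr x)) => [|i]; last by rewrite fE.
split=> [a x y|x y].
  rewrite -fl -[RHS]fE; congr (f (repr _)).
  rewrite -[x in LHS]reprK -[y in LHS]reprK; apply/esym.
  by rewrite /pi -mb_addE -mb_scaleE.
rewrite -fb -[RHS]fE; congr (f (repr _)).
by rewrite -[x in LHS]reprK -[y in LHS]reprK; apply/esym; rewrite /pi -mb_brE.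
Qed.

End MetabelianLie.

(** * The Magnus algebra *)

Section MagnusAlgebra.
Variables (K : fieldType) (m : nat).

(* The abelian Lie algebra K^m extended by the free K[X_1, ..., X_m]-module of
   rank m, on which the i-th basis vector of K^m acts as X_i. *)
Definition magnus : Type := 'rV[K]_m * {ffun 'I_m -> {mpoly K[m]}}.
HB.instance Definition _ := GRing.Lmodule.on magnus.

Definition linpoly (a : 'rV[K]_m) : {mpoly K[m]} := \sum_i a 0 i *: 'X_i.

Lemma linpolyP k a b : linpoly (k *: a + b) = k *: linpoly a + linpoly b.
Proof.
rewrite scaler_sumr -big_split /=; apply: eq_bigr => i _.
by rewrite !mxE scalerDl scalerA.
Qed.

Lemma linpoly_delta i : linpoly (delta_mx 0 i) = 'X_i.
Proof.
rewrite /linpoly (bigD1 i) //= mxE !eqxx scale1r big1 ?addr0 // => j /negPf ji.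
by rewrite mxE ji andbF scale0r.
Qed.

Lemma linpoly0 : linpoly 0 = 0.
Proof. by rewrite /linpoly big1 // => i _; rewrite mxE scale0r. Qed.

Definition magnus_br (x y : magnus) : magnus :=
  (0, [ffun i => x.2 i * linpoly y.1 - y.2 i * linpoly x.1]).

Fact magnus_brC x y : magnus_br x y = - magnus_br y x.
Proof.
by rewrite /magnus_br; congr pair; rewrite ?oppr0 //; apply/ffunP => i;
  rewrite !ffunE opprB.
Qed.

Fact magnus_brP k x y z :
  magnus_br (k *: x + y) z = k *: magnus_br x z + magnus_br y z.
Proof.
congr pair; first by rewrite /= scaler0 addr0.
apply/ffunP => i; rewrite !ffunE /= linpolyP -!mul_mpolyC; ring.
Qed.

Fact magnus_brDl x y z : magnus_br (x + y) z = magnus_br x z + magnus_br y z.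
Proof. by have := magnus_brP 1 x y z; rewrite !scale1r. Qed.

Fact magnus_brxx x : magnus_br x x = 0.
Proof. by congr pair; apply/ffunP => i; rewrite !ffunE subrr. Qed.

Fact magnus_brZl k x y : magnus_br (k *: x) y = k *: magnus_br x y.
Proof.
have := magnus_brP k x 0 y; rewrite !addr0 => ->.
by have := magnus_brP (-1) 0 0 y; rewrite scaler0 addr0 scaleN1r addNr => ->;
  rewrite addr0.
Qed.

Fact magnus_brDr x y z : magnus_br x (y + z) = magnus_br x y + magnus_br x z.
Proof. by rewrite magnus_brC magnus_brDl opprD -!magnus_brC. Qed.

Fact magnus_brZr k x y : magnus_br x (k *: y) = k *: magnus_br x y.
Proof. by rewrite magnus_brC magnus_brZl -scalerN -magnus_brC. Qed.

Fact magnus_jacobi x y z :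
  magnus_br x (magnus_br y z) + magnus_br y (magnus_br z x) +
  magnus_br z (magnus_br x y) = 0.
Proof.
congr pair; first by rewrite /= !addr0.
by apply/ffunP => i; rewrite !ffunE /= linpoly0; ring.
Qed.

HB.instance Definition _ := Lmodule_isLie.Build K magnus
  magnus_brDl magnus_brZl magnus_brDr magnus_brZr magnus_brxx magnus_jacobi.

Lemma magnus_metabelian : is_metabelian magnus.
Proof.
move=> a b c d; congr pair; apply/ffunP => i; rewrite ffunE.
by rewrite [in RHS]ffunE /= linpoly0; ring.
Qed.

End MagnusAlgebra.

(** * Polynomials acting on the derived algebra *)

Section MonomialAction.
Variables (K : fieldType) (L : lieAlgType K) (m : nat) (y : 'I_m -> L).
Hypothesis metL : is_metabelian L.

Definition word_act (s : seq 'I_m) (w : L) : L := foldr (fun k z => ⟦z, y k⟧) w s.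

Lemma word_act_derived1 s w : derived1 w -> derived1 (word_act s w).
Proof. by case: s => //= k s _; apply: derived1_br. Qed.

Lemma word_act_rem s w j : derived1 w -> j \in s ->
  word_act s w = ⟦word_act (rem j s) w, y j⟧.
Proof.
move=> dw; elim: s => //= k s IH.
rewrite inE; case: (eqVneq k j) => [->|_] //= /IH ->.
by rewrite derived1_brC //; apply: word_act_derived1.
Qed.

(** The operators commute on the derived algebra, so a monomial may act through the fixed word
    [m2s]. *)
Lemma word_act_perm s s' w : derived1 w -> perm_eq s s' ->
  word_act s w = word_act s' w.
Proof.
move=> dw; elim: s s' => [|k s IH] s' pss'.
  by move: pss'; rewrite perm_sym => /perm_nilP ->.
have ks' : k \in s' by rewrite -(perm_mem pss') mem_head.
rewrite (word_act_rem dw ks') /= (IH (rem k s')) //.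
by rewrite -(perm_cons k) (perm_trans pss') // perm_to_rem.
Qed.

Definition mnm_act (g : 'X_{1..m}) (w : L) : L := word_act (m2s g) w.

Lemma mnm_act0 w : mnm_act 0%MM w = w.
Proof.
rewrite /mnm_act (_ : m2s _ = [::]) //.
by apply/nilP; rewrite /nilp size_m2s mdeg0.
Qed.

Lemma mnm_actU g k w : derived1 w ->
  mnm_act (g + U_(k))%MM w = ⟦mnm_act g w, y k⟧.
Proof.
move=> dw; apply: (word_act_perm (s' := k :: m2s g) dw).
apply/allP => j _; apply/eqP.
have cnt (h : 'X_{1..m}) i : count_mem i (m2s h) = h i.
  by rewrite -[in RHS](s2mK h) mnmE.
by rewrite /= !cnt mnmDE mnm1E addnC.
Qed.

Definition poly_act (w : L) (p : {mpoly K[m]}) : L :=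
  \sum_(g <- msupp p) p@_g *: mnm_act g w.

(** Trading the support for a degree bound gives several polynomials a common index set, as
    linearity requires. *)
Lemma poly_actwE w p k : (msize p <= k)%N ->
  poly_act w p = \sum_(g : 'X_{1..m < k}) p@_g *: mnm_act g w.
Proof.
move=> le_pk; set I : subFinType _ := 'X_{1..m < k}.
rewrite /poly_act (big_mksub I) ?msupp_uniq //=; last first.
  by move=> x /msize_mdeg_lt /leq_trans; apply.
by rewrite big_rmcond //= => j /memN_msupp_eq0 ->; rewrite scale0r.
Qed.

Lemma poly_actP w a p q :
  poly_act w (a *: p + q) = a *: poly_act w p + poly_act w q.
Proof.
pose k := maxn (msize (a *: p + q)) (maxn (msize p) (msize q)).
rewrite !(@poly_actwE w _ k) ?leq_max ?leqnn ?orbT //.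
rewrite scaler_sumr -big_split /=; apply: eq_bigr => g _.
by rewrite mcoeffD mcoeffZ scalerDl scalerA.
Qed.

HB.instance Definition _ w := GRing.isLinear.Build K {mpoly K[m]} L _
  (poly_act w) (poly_actP w).

Lemma poly_act_mnm g w : poly_act w 'X_[g] = mnm_act g w.
Proof. by rewrite /poly_act msuppX big_seq1 mcoeffX eqxx scale1r. Qed.

Lemma poly_act1 w : poly_act w 1 = w.
Proof. by rewrite -mpolyX0 poly_act_mnm mnm_act0. Qed.

Lemma poly_actMX p k w : derived1 w ->
  poly_act w (p * 'X_k) = ⟦poly_act w p, y k⟧.
Proof.
move=> dw; elim/mpolyind: p => [|c g p _ _ IH].
  by rewrite mul0r linear0 lie0b.
rewrite mulrDl -scalerAl -mpolyXD !poly_actP IH !poly_act_mnm mnm_actU //.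
by rewrite liebDl liebZl.
Qed.

End MonomialAction.

(** * Koszul homotopy and injectivity of the Magnus embedding *)

Section Centre.
Variables (K : fieldType) (m : nat).
Hypothesis charK : [pchar K] =i pred0.
Local Notation L := (free_metab K m).
Local Notation homogeneous := (@Defs.homog K m).
Local Notation y := (fm_gen K (m := m)).

Let metL : is_metabelian L := @metab_metabelian K (free_lie K m).

Lemma sum_delta (V : nmodType) (F : 'I_m -> V) a : \sum_i F i *+ (a == i) = F a.
Proof.
rewrite (bigD1 a) //= eqxx big1 ?addr0 // => i /negPf.
by rewrite eq_sym => ->.
Qed.

Lemma homog1_gen (x : L) : homogeneous 1 x ->
  exists a : 'I_m -> K, x = \sum_i a i *: y i.
Proof.
have pos d z : lie_monomial d z -> (0 < d)%N.
  by elim=> // j k ? ? _ j0 _ _; rewrite addn_gt0 j0.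
elim=> [|c z t mz _ [a ->]].
  by exists (fun=> 0); rewrite big1 // => i _; rewrite scale0r.
have gen d w : lie_monomial d w -> d = 1%N -> exists i, w = y i.
  case=> [i|j k p q /pos j0 /pos k0 jk]; first by exists i.
  by move: j0 k0 jk; case: j k => [|j] [|k] //; rewrite addSn addnS.
have [i ->] := gen _ _ mz erefl.
exists (fun j => c *+ (i == j) + a j).
under [RHS]eq_bigr do rewrite scalerDl -scalerMnl.
by rewrite big_split /= (sum_delta (fun j => c *: y j)).
Qed.

Lemma homog_derived1 d (x : L) : homogeneous d.+2 x -> derived1 x.
Proof.
move/homog_ad_gen => [g _ ->]; apply: lspan_sum => i _; exact: derived1_br.
Qed.

Variable phi : L -> magnus K m.
Hypothesis phi_hom : is_lie_hom phi.
Hypothesis phi_gen : forall i,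
  phi (y i) = (delta_mx 0 i, [ffun j => (i == j)%:R]).

Lemma phi_linear a x z i :
  (phi (a *: x + z)).2 i = a *: (phi x).2 i + (phi z).2 i.
Proof. by rewrite phi_hom.1 !ffunE. Qed.

Lemma phi0 : phi 0 = 0.
Proof.
by have := phi_hom.1 (-1) 0 0; rewrite scaler0 addr0 scaleN1r addNr.
Qed.

Lemma phi_derived1 x : derived1 x -> (phi x).1 = 0.
Proof.
elim=> [|a x' z [p [q [_ _ ->]]] _ IH]; first by rewrite phi0.
by rewrite phi_hom.1 phi_hom.2 /= IH scaler0 addr0.
Qed.

Lemma phi_brX x k i : derived1 x -> (phi ⟦x, y k⟧).2 i = (phi x).2 i * 'X_k.
Proof.
move=> dx; rewrite phi_hom.2 ffunE phi_gen /= phi_derived1 //.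
by rewrite linpoly_delta linpoly0 mulr0 subr0.
Qed.

(** With p_i the coordinates of [phi z], the module part of the image of this sum under [phi] is X_k
    sum_i p_i e_i - (sum_i p_i X_i) e_k, and the last term vanishes on cycles. *)
Definition contraction (k : 'I_m) (z : L) : L :=
  \sum_i poly_act y ⟦y i, y k⟧ ((phi z).2 i).

(* [phi z] is a cycle of the Koszul complex of K[X_1, ..., X_m].  On homogeneous
   z, the Koszul homotopy built from the partial derivatives gives back a multiple
   of z by its degree, so that phi is injective in characteristic 0. *)
Definition euler (z : L) : L :=
  \sum_i \sum_k poly_act y ⟦y i, y k⟧ ((phi z).2 i)^`M(k).

(** The first clause serves the induction on degree: it evaluates the extra term of the product
    rule. *)
Definition koszul_homotopic d z : Prop :=
  (forall k, contraction k z = ⟦z, y k⟧) /\ euler z = d%:R *: z.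

Lemma koszul_homotopicP d a x z : koszul_homotopic d x -> koszul_homotopic d z ->
  koszul_homotopic d (a *: x + z).
Proof.
move=> [cx ex] [cz ez]; split=> [k|].
  rewrite liebDl liebZl -cx -cz scaler_sumr -big_split /=.
  by apply: eq_bigr => i _; rewrite phi_linear linearP.
rewrite scalerDr scalerA mulrC -scalerA -ex -ez scaler_sumr -big_split /=.
apply: eq_bigr => i _; rewrite scaler_sumr -big_split /=.
by apply: eq_bigr => k _; rewrite phi_linear mderivD mderivZ linearP.
Qed.

Lemma koszul_homotopic0 d : koszul_homotopic d 0.
Proof.
split=> [k|]; rewrite ?lie0b ?scaler0 /contraction /euler phi0 big1 // => i _.
  by rewrite ffunE linear0.
by rewrite big1 // => k _; rewrite ffunE mderiv0 linear0.
Qed.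

Lemma koszul_homotopic_sum I (r : seq I) (F : I -> L) d :
  (forall i, koszul_homotopic d (F i)) -> koszul_homotopic d (\sum_(i <- r) F i).
Proof.
move=> H; elim/big_ind: _ => //; first exact: koszul_homotopic0.
by move=> x z hx hz; rewrite -[x]scale1r; apply: koszul_homotopicP.
Qed.

Lemma mderiv_var (a k : 'I_m) : ('X_a : {mpoly K[m]})^`M(k) = 1 *+ (a == k).
Proof.
rewrite mderivX mnm1E; case: eqVneq => [->|_]; last by rewrite scale0r.
rewrite scale1r -mpolyX0; congr 'X_[_]; apply/mnmP => i.
by rewrite mnmBE subnn mnm0E.
Qed.

Lemma koszul_homotopic_gen a b : koszul_homotopic 2 ⟦y a, y b⟧.
Proof.
have phiE i : (phi ⟦y a, y b⟧).2 i = 'X_b *+ (a == i) + (- 'X_a) *+ (b == i).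
  rewrite phi_hom.2 !phi_gen ffunE /= !ffunE !linpoly_delta.
  by rewrite !mulr_natl mulNrn.
split=> [k|].
  rewrite /contraction; under eq_bigr do rewrite phiE linearD /= !linearMn /=.
  rewrite big_split /= !sum_delta linearN /= -['X_b]mul1r -['X_a]mul1r.
  rewrite !(poly_actMX _ metL) ?poly_act1; try exact: derived1_br.
  rewrite [RHS]liebC lieb_leibniz (liebC (y k) (y a)) (liebC (y k) (y b)).
  by rewrite !liebNl opprB addrC opprK.
have dE (i k : 'I_m) : poly_act y ⟦y i, y k⟧ ((phi ⟦y a, y b⟧).2 i)^`M(k) =
    ⟦y i, y k⟧ *+ (b == k) *+ (a == i) + (- ⟦y i, y k⟧) *+ (a == k) *+ (b == i).
  rewrite phiE mderivD !mderivMn mderivN !mderiv_var linearD /= -mulNrn.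
  by rewrite !linearMn /= linearN /= poly_act1.
rewrite /euler (eq_bigr (fun i => ⟦y i, y b⟧ *+ (a == i) +
    (- ⟦y i, y a⟧) *+ (b == i))); last first.
  move=> i _; rewrite (eq_bigr _ (fun k _ => dE i k)) big_split /= !sumrMnl.
  rewrite (sum_delta (fun k => ⟦y i, y k⟧)).
  by rewrite (sum_delta (fun k => - ⟦y i, y k⟧)).
rewrite big_split /= (sum_delta (fun i => ⟦y i, y b⟧)).
rewrite (sum_delta (fun i => - ⟦y i, y a⟧)) -liebC.
by rewrite scaler_nat mulr2n.
Qed.

(** In the derivatives of p_i X_k, differentiating p_i gives d copies of [⟦z, y k⟧], and
    differentiating X_k gives [contraction k z], one more copy. *)
Lemma koszul_homotopic_br d z k : derived1 z -> koszul_homotopic d z ->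
  koszul_homotopic d.+1 ⟦z, y k⟧.
Proof.
rewrite /koszul_homotopic /contraction => dz [cz ez]; split=> [l|].
  rewrite (derived1_brC metL) // -[in RHS]cz lieb_suml; apply: eq_bigr => i _.
  by rewrite phi_brX // (poly_actMX _ metL) //; apply: derived1_br.
rewrite -addn1 natrD scalerDl scale1r -liebZl -ez -[in X in _ + X]cz.
rewrite /euler /contraction lieb_suml -big_split /=; apply: eq_bigr => i _.
under eq_bigr => l _ do
  rewrite phi_brX // mderivM mderiv_var linearD /= mulrnAr mulr1 linearMn /=
    (poly_actMX _ metL _ _ (derived1_br _ _)).
rewrite big_split /= lieb_suml; congr (_ + _).
exact: (sum_delta (fun l => poly_act y ⟦y i, y l⟧ ((phi z).2 i))).
Qed.

Lemma homog_koszul d z : homogeneous d.+2 z -> koszul_homotopic d.+2 z.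
Proof.
elim: d z => [|d IH] z /homog_ad_gen[g gh ->]; apply: koszul_homotopic_sum => k.
  have [a ->] := homog1_gen (gh k); rewrite lieb_suml.
  apply: koszul_homotopic_sum => i.
  rewrite liebZl -[X in koszul_homotopic _ X]addr0.
  by apply: koszul_homotopicP (koszul_homotopic0 _); apply: koszul_homotopic_gen.
by apply: koszul_homotopic_br (IH _ (gh k)); apply: homog_derived1 (gh k).
Qed.

(** [euler z] depends only on the module part of [phi z], and characteristic 0 allows division by
    the degree. *)
Lemma phi_inj d z : homogeneous d.+2 z -> (phi z).2 = 0 -> z = 0.
Proof.
move=> /homog_koszul[_ + pz]; rewrite /euler pz big1 => [/esym/eqP|i _].
  by rewrite scaler_eq0 (negPf (char0_neq0 charK _)) => /eqP.
by rewrite big1 // => k _; rewrite ffunE mderiv0 linear0.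
Qed.

Lemma phi_lin (a : 'I_m -> K) i :
  (phi (\sum_j a j *: y j)).2 i = (a i)%:MP.
Proof.
have -> : (phi (\sum_j a j *: y j)).2 i = \sum_j a j *: (phi (y j)).2 i.
  elim/big_rec2: _ => [|j p q _ <-]; last by rewrite phi_linear.
  by rewrite phi0 ffunE.
rewrite (bigD1 i) //= phi_gen ffunE eqxx big1 ?addr0 ?alg_mpolyC // => j ji.
by rewrite phi_gen ffunE (negPf ji) scaler0.
Qed.

End Centre.

Lemma free_metab_centre (K : fieldType) (m d : nat) (z : free_metab K m) :
    [pchar K] =i pred0 -> (2 <= m)%N -> Defs.homog d z ->
  (forall k, ⟦z, fm_gen K k⟧ = 0) -> z = 0.
Proof.
move=> charK hm.
have [phi phi_hom phi_gen] := @metab_universal K m (magnus K m)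
  (fun i => (delta_mx 0 i, [ffun j => (i == j)%:R])) (@magnus_metabelian K m).
have X_reg (p : {mpoly K[m]}) k : p * 'X_k = 0 -> p = 0.
  by move=> pX; apply/mpolyP => g; rewrite -(mcoeffMX p U_(k)) pX !mcoeff0.
case: d => [/homog0 //|[|d] hz cz].
  (* In degree 1, coordinate i of the image of the bracket with generator k is a_i X_k for k
     different from i; such a k exists since m >= 2. *)
  have [a zE] := homog1_gen hz.
  rewrite zE big1 // => i _.
  have [k ki] : exists k, i != k.
    have m0 : (0 < m)%N by exact: ltn_trans hm.
    pose o0 := Ordinal m0; pose o1 := Ordinal hm.
    by case: (eqVneq i o0) => [->|]; [exists o1 | exists o0].
  have := congr1 (fun x => (phi x).2 i) (cz k).
  rewrite phi_hom.2 ffunE phi_gen /= linpoly_delta zE phi_lin // ffunE eq_sym.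
  rewrite (negPf ki) mul0r subr0 (phi0 phi_hom) ffunE => /X_reg/eqP.
  by rewrite mpolyC_eq0 => /eqP ->; rewrite scale0r.
(* In higher degree, bracketing with a generator multiplies the module part by a variable, which is
   not a zero divisor. *)
apply: (phi_inj charK phi_hom phi_gen hz); apply/ffunP => i; rewrite ffunE.
pose k : 'I_m := Ordinal hm; apply: (@X_reg _ k).
rewrite -(phi_brX phi_hom phi_gen) ?cz ?(phi0 phi_hom) ?ffunE //.
exact: homog_derived1 hz.
Qed.

(** * The action of power series on the completion *)

Lemma sum_ord_widen (V : nmodType) (n N : nat) (F : nat -> V) : (n <= N)%N ->
  (forall i, (n <= i)%N -> F i = 0) -> \sum_(i < n) F i = \sum_(i < N) F i.
Proof.
move=> nN F0; rewrite (big_ord_widen N F nN).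
rewrite [RHS](bigID (fun i : 'I_N => (i < n)%N)) /=.
by rewrite [X in _ = _ + X]big1 ?addr0 // => i; rewrite -leqNgt => /F0.
Qed.

Lemma sum_convolution (V : zmodType) (n : nat) (F : nat -> nat -> V) :
    (forall i j, (n < i + j)%N -> F i j = 0) ->
  \sum_(k < n.+1) \sum_(i < k.+1) F i (k - i)%N =
  \sum_(i < n.+1) \sum_(j < n.+1) F i j.
Proof.
move=> F0; rewrite (conv_assoc n (fun i j _ => F i j)); apply: eq_bigr => i _.
by apply: (@sum_ord_widen _ _ _ (F i)) => [|j ij]; [|apply: F0]; lia.
Qed.

Section HatAction.
Variables (K : fieldType) (m : nat).
Local Notation hat := (fm_hat K m).

Lemma hat_metabelian : is_metabelian hat.
Proof.
move=> p q r s; apply: hatP => n; rewrite hat_comp_br big1 // => i _.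
rewrite !hat_comp_br lieb_suml big1 // => j _; rewrite lieb_sumr big1 // => k _.
exact: (@metab_metabelian K (free_lie K m)).
Qed.

Variables a b : hat.

Definition ad_mono (i j : nat) (f : hat) : hat :=
  iter j (adr b) (iter i (adr a) f).

Lemma adrP (u : hat) k x z : adr u (k *: x + z) = k *: adr u x + adr u z.
Proof. by rewrite /adr liebDl liebZl. Qed.

Lemma iter_adrP u i k (x z : hat) :
  iter i (adr u) (k *: x + z) = k *: iter i (adr u) x + iter i (adr u) z.
Proof. by elim: i => //= i ->; rewrite adrP. Qed.

Lemma iter_adr_derived1 u i (f : hat) :
  derived1 f -> derived1 (iter i (adr u) f).
Proof. by case: i => //= i _; apply: derived1_br. Qed.

Lemma iter_adrC u x i (f : hat) : derived1 f ->
  iter i (adr u) (adr x f) = adr x (iter i (adr u) f).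
Proof.
move=> df; elim: i => //= i ->; apply: (derived1_brC hat_metabelian).
exact: iter_adr_derived1.
Qed.

Lemma ad_mono_derived1 i j f : derived1 f -> derived1 (ad_mono i j f).
Proof. by move=> df; do 2!apply: iter_adr_derived1. Qed.

Lemma ad_monoC i j x f : derived1 f ->
  ad_mono i j (adr x f) = adr x (ad_mono i j f).
Proof.
by move=> df; rewrite /ad_mono !iter_adrC //; apply: iter_adr_derived1.
Qed.

Lemma ad_monoM i j k l f : derived1 f ->
  ad_mono i j (ad_mono k l f) = ad_mono (i + k) (j + l) f.
Proof.
move=> df; rewrite /ad_mono !iterD; congr (iter j _ _).
elim: l => //= l <-; rewrite iter_adrC //.
by do 2!apply: iter_adr_derived1.
Qed.

Lemma ad_mono_order i j f n : (n < i + j)%N -> ad_mono i j f n = 0.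
Proof.
move=> nij; apply: (@iter_adr_order K m b _ j i); last by rewrite addnC.
by move=> k ki; apply: (@iter_adr_order K m a f i 0); rewrite ?addn0.
Qed.

(** Monomials of total degree above n contribute nothing in degree n, so any large enough square
    truncation is exact there. *)
Lemma ps_actwE N p f n : (n < N)%N -> ps_act p a b f n =
  \sum_(i < N) \sum_(j < N) coef2 p i j *: ad_mono i j f n.
Proof.
move=> nN; have T0 i j : (n < i + j)%N -> coef2 p i j *: ad_mono i j f n = 0.
  by move=> nij; rewrite ad_mono_order ?scaler0.
rewrite -(@sum_ord_widen _ n.+1 N
  (fun i => \sum_(j < N) coef2 p i j *: ad_mono i j f n)) //.
  apply: eq_bigr => i _.
  apply: (@sum_ord_widen _ _ _
    (fun j => coef2 p i j *: ad_mono i j f n)) => // j nj.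
  by apply: T0; rewrite ltn_addl.
by move=> i ni; rewrite big1 // => j _; rewrite T0 // ltn_addr.
Qed.

Lemma ps_act_mono p k l f :
    (forall i j, coef2 p i j = ((i == k) && (j == l))%:R) ->
  ps_act p a b f = ad_mono k l f.
Proof.
(* The bound exceeds k and l too, so that the surviving monomial lies in the truncation. *)
move=> pE; apply: hatP => n; pose N := (n + k + l).+1.
have [kN lN] : (k < N)%N /\ (l < N)%N by rewrite /N; lia.
rewrite (@ps_actwE N); last by rewrite /N; lia.
rewrite (bigD1 (Ordinal kN)) //= [X in X + _](bigD1 (Ordinal lN)) //=.
rewrite pE !eqxx scale1r.
rewrite !big1 ?addr0 // => [i|j]; rewrite -val_eqE => /negPf /= ne.
  by rewrite big1 // => j _; rewrite pE ne scale0r.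
by rewrite pE ne andbF scale0r.
Qed.

Lemma ps_actDl p q f :
  ps_act (p + q) a b f = ps_act p a b f + ps_act q a b f.
Proof.
apply: hatP => n; rewrite hat_compD !(@ps_actwE n.+1) // -big_split.
apply: eq_bigr => i _; rewrite -big_split; apply: eq_bigr => j _.
by rewrite coef2D scalerDl.
Qed.

Lemma ps_actP p k f g :
  ps_act p a b (k *: f + g) = k *: ps_act p a b f + ps_act p a b g.
Proof.
apply: hatP => n; rewrite hat_compD hat_compZ !(@ps_actwE n.+1) //.
rewrite scaler_sumr -big_split; apply: eq_bigr => i _.
rewrite scaler_sumr -big_split; apply: eq_bigr => j _.
rewrite /ad_mono !iter_adrP hat_compD hat_compZ scalerDr !scalerA.
by rewrite mulrC.
Qed.

Lemma ps_actDr p f g : ps_act p a b (f + g) = ps_act p a b f + ps_act p a b g.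
Proof. by have := ps_actP p 1 f g; rewrite !scale1r. Qed.

Lemma ps_act_derived1 p f : derived1 f -> derived1 (ps_act p a b f).
Proof.
move=> df; apply/hat_derived1P; rewrite (@ps_actwE 2) // big1 // => i _.
rewrite big1 // => j _; have /hat_derived1P -> := ad_mono_derived1 i j df.
by rewrite scaler0.
Qed.

Lemma adr_ps_act p x f : derived1 f ->
  adr x (ps_act p a b f) = ps_act p a b (adr x f).
Proof.
move=> df; apply: hatP => n; rewrite (@ps_actwE n.+1) // hat_comp_br.
under eq_bigr => l _ do rewrite (@ps_actwE n.+1) // lieb_suml.
rewrite exchange_big; apply: eq_bigr => i _ /=.
under eq_bigr => l _ do rewrite lieb_suml.
rewrite exchange_big; apply: eq_bigr => j _ /=.
rewrite ad_monoC // hat_comp_br scaler_sumr; apply: eq_bigr => l _.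
by rewrite liebZl.
Qed.

Lemma coef2M (p q : fps2 K) i j : coef2 (p * q) i j =
  \sum_(k < i.+1) \sum_(l < j.+1) coef2 p k l * coef2 q (i - k) (j - l).
Proof. by rewrite /coef2 coef_fpsM coef_fps_sum exchange_big. Qed.

Lemma ad_mono_ps_act i j p f : derived1 f ->
  ad_mono i j (ps_act p a b f) = ps_act p a b (ad_mono i j f).
Proof.
move=> df; rewrite /ad_mono; have H u g k : derived1 g ->
    iter k (adr u) (ps_act p a b g) = ps_act p a b (iter k (adr u) g).
  move=> dg; elim: k => //= k ->; apply: adr_ps_act; exact: iter_adr_derived1.
by rewrite !H //; apply: iter_adr_derived1.
Qed.

(** Monomials multiply because the operators commute on the commutator ideal; the rest rearranges a
    Cauchy product in each degree. *)
Lemma ps_actM p q f : derived1 f ->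
  ps_act (p * q) a b f = ps_act p a b (ps_act q a b f).
Proof.
move=> df; apply: hatP => n; rewrite !(@ps_actwE n.+1) //.
(* [F] pairs the monomial t1^i t2^j of [p] with t1^k t2^l of [q]; its vanishing for large exponents
   turns convolutions into sums over squares. *)
pose F i j k l := (coef2 p i j * coef2 q k l) *: ad_mono (i + k) (j + l) f n.
have F0 i j k l : (n < i + k)%N || (n < j + l)%N -> F i j k l = 0.
  by move=> H; rewrite /F ad_mono_order ?scaler0 //; lia.
transitivity (\sum_(k < n.+1) \sum_(i < k.+1)
    \sum_(l < n.+1) \sum_(j < l.+1) F i j (k - i)%N (l - j)%N).
  apply: eq_bigr => k _; rewrite [RHS]exchange_big; apply: eq_bigr => l _.
  rewrite coef2M scaler_suml; apply: eq_bigr => i _.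
  rewrite scaler_suml; apply: eq_bigr => j _.
  by rewrite /F !subnKC -1?ltnS.
pose G i k := \sum_(l < n.+1) \sum_(j < l.+1) F i j k (l - j)%N.
rewrite (@sum_convolution _ n G) => [|i k nik]; last first.
  by rewrite /G big1 // => l _; rewrite big1 // => j _; rewrite F0 // nik.
apply: eq_bigr => i _; under eq_bigr => k _.
  rewrite /G (@sum_convolution _ n (fun j l => F i j k l)) => [|j l njl];
    last first.
    by rewrite F0 // njl orbT.
over.
rewrite exchange_big; apply: eq_bigr => j _ /=.
rewrite ad_mono_ps_act // (@ps_actwE n.+1) // scaler_sumr.
apply: eq_bigr => k _.
rewrite scaler_sumr; apply: eq_bigr => l _.
by rewrite ad_monoM // /F scalerA (addnC i) (addnC j).
Qed.


Lemma ps_act1 f : ps_act 1 a b f = f.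
Proof. by rewrite (ps_act_mono f (coef2_1 K)). Qed.

Lemma ps_act_t1 f : ps_act (t1 K) a b f = adr a f.
Proof. by apply: (@ps_act_mono (t1 K) 1 0) => i j; apply: (coef2_t1X K 1). Qed.

Lemma ps_act_t2 f : ps_act (t2 K) a b f = adr b f.
Proof. by apply: (@ps_act_mono (t2 K) 0 1) => i j; apply: (coef2_t2X K 1). Qed.

(** As [s ^+ k] has order at least k, only k <= n matters in degree n. *)
Lemma ps_act_subst p s f n :
    (forall k i j, (i + j < k)%N -> coef2 (s ^+ k) i j = 0) ->
  ps_act (fps_subst p s) a b f n =
  \sum_(k < n.+1) coefs p k *: ps_act (s ^+ k) a b f n.
Proof.
move=> s0; under [RHS]eq_bigr do rewrite (@ps_actwE n.+1) // scaler_sumr.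
rewrite [RHS]exchange_big (@ps_actwE n.+1) //; apply: eq_bigr => i _ /=.
under [RHS]eq_bigr do rewrite scaler_sumr.
rewrite [RHS]exchange_big; apply: eq_bigr => j _ /=.
under [RHS]eq_bigr do rewrite scalerA.
rewrite -scaler_suml; have [ijn|nij] := leqP (i + j) n; last first.
  by rewrite ad_mono_order ?scaler0.
congr (_ *: _); apply: (@sum_ord_widen _ _ _
  (fun k => coefs p k * coef2 (s ^+ k) i j)) => // k.
by move=> /s0 ->; rewrite mulr0.
Qed.

Section ExpAd.
Variables (s : fps2 K) (u : hat).
Hypothesis s_order : forall k i j, (i + j < k)%N -> coef2 (s ^+ k) i j = 0.
Hypothesis su : forall f, derived1 f -> ps_act s a b f = adr u f.

Lemma ps_actX k f : derived1 f -> ps_act (s ^+ k) a b f = iter k (adr u) f.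
Proof.
move=> df; elim: k => [|k IH]; first by rewrite expr0 ps_act1.
by rewrite exprS ps_actM // IH su //; apply: iter_adr_derived1.
Qed.

(** After the zeroth term, the first bracket of each term lands in the commutator ideal, where [s]
    acts as [ad u]; the remaining coefficients 1/(k+1)! are those of h. *)
Lemma exp_adE x :
  exp_ad u x = x + ps_act (fps_subst (h_series K) s) a b ⟦x, u⟧.
Proof.
apply: hatP => n; rewrite hat_compD ps_act_subst //.
rewrite [LHS]big_ord_recl /exp_term hat_compZ fact0 invr1 scale1r; congr (_ + _).
have dxu : derived1 ⟦x, u⟧ by exact: derived1_br.
(* The right-hand sum has one term more; it is zero, since n brackets applied to [⟦x, u⟧] start in
   degree n + 1. *)
rewrite big_ord_recr ps_actX // (@iter_adr_order _ _ u ⟦x, u⟧ n 1) ?addn1 //.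
  rewrite scaler0 [RHS]Monoid.mulm1; apply: eq_bigr => k _.
  by rewrite hat_compZ ps_actX // coef_h lift0 iterSr.
by move=> [|//] _; rewrite hat_comp0.
Qed.

End ExpAd.
End HatAction.

(** * Identities between power series *)

Section SeriesIdentities.
Variable K : fieldType.
Local Notation t1 := (t1 K).
Local Notation t2 := (t2 K).
Local Notation h := (h_series K).

Lemma t1_order k i j : (i + j < k)%N -> coef2 (t1 ^+ k) i j = 0.
Proof. by rewrite coef2_t1X; case: eqP => // ->; case: j => //= j; lia. Qed.

Lemma t2_order k i j : (i + j < k)%N -> coef2 (t2 ^+ k) i j = 0.
Proof. by rewrite coef2_t2X andbC; case: eqP => //= ->; lia. Qed.

Lemma tD_order k i j : (i + j < k)%N -> coef2 ((t1 + t2) ^+ k) i j = 0.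
Proof. by move=> ijk; rewrite coef2_tDX ltn_eqF. Qed.

Lemma t1_subst_h : t1 * fps_subst h t1 = fps_subst (fps_exp K) t1 - 1.
Proof.
apply: fps2P => i j; rewrite coef2B coef2_t1M coef2_1 !coef2_subst_t1 /=.
case: i j => [|i] [|j] //=; rewrite ?subr0 ?subrr //.
- by rewrite fact0 invr1 subrr.
- by rewrite coef2_subst_t1 /= coef_h.
by rewrite coef2_subst_t1.
Qed.

Lemma t2_subst_h : t2 * fps_subst h t2 = fps_subst (fps_exp K) t2 - 1.
Proof.
apply: fps2P => i j; rewrite coef2B coef2_t2M coef2_1 !coef2_subst_t2 /=.
case: i j => [|i] [|j] //=; rewrite ?subr0 ?subrr //.
- by rewrite fact0 invr1 subrr.
- by rewrite coef2_subst_t2 /= coef_h.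
by rewrite coef2_subst_t2.
Qed.

(** Coefficientwise this is Pascal's rule. *)
Lemma tD_subst_h : (t1 + t2) * fps_subst h (t1 + t2) = c_den K.
Proof.
apply: fps2P => i j.
rewrite mulrDl coef2D coef2_t1M coef2_t2M /c_den coef2B coef2_1 coef2_subst_tD /=.
case: i j => [|i] [|j]; rewrite ?coef2_subst_tD ?coef_h /= ?add0r ?addr0 ?subr0.
- by rewrite fact0 invr1 mulr1 subrr.
- by rewrite !bin0.
- by rewrite !addn0 !binn.
by rewrite !addSn !addnS -mulrDr [in RHS]binS natrD [in RHS]addrC.
Qed.

Hypothesis charK : [pchar K] =i pred0.

Lemma exp_tD : fps_subst (fps_exp K) (t1 + t2) =
  fps_subst (fps_exp K) t1 * fps_subst (fps_exp K) t2.
Proof.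
apply: fps2P => i j; rewrite mulrC coef2_exp_t2M.
transitivity ((i`!%:R * j`!%:R)^-1 : K).
  (* Subtracting 1 reduces to the known coefficients of [c_den]. *)
  apply: (addIr (- coef2 1 i j)); rewrite -[LHS]/(coef2 (c_den K) i j).
  by rewrite coef2_c_den // coef2_1.
rewrite big_ord_recr /= subnn coef2_subst_t1 /= invfM mulrC big1 ?add0r // => k _.
by rewrite coef2_subst_t1 subn_eq0 leqNgt ltn_ord mulr0.
Qed.

Lemma fps2_mulfI (r p q : fps2 K) : r != 0 -> r * p = r * q -> p = q.
Proof.
have dom (p' q' : fps K) : p' * q' = 0 -> p' = 0 \/ q' = 0.
  apply: fps_mulf_eq0 => a b /eqP; rewrite mulf_eq0.
  by case/orP => /eqP; [left | right].
move=> r0 /eqP; rewrite -subr_eq0 -mulrBr => /eqP /(fps_mulf_eq0 dom).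
by case=> [/eqP|/eqP]; rewrite ?(negPf r0) // subr_eq0 => /eqP.
Qed.

Lemma tD_neq0 : t1 + t2 != 0.
Proof.
apply/eqP => /(congr1 (fun p => coef2 p 1 0)); rewrite -[t1 + t2]expr1 coef2_tDX.
by rewrite /= /coef2 !coef_fps0 => /eqP; rewrite oner_eq0.
Qed.

(** Multiplying by t1 + t2 turns h(t1 + t2) into [c_den], which clears the denominator of c; with
    e^t = t h(t) + 1 a polynomial identity remains. *)
Lemma c_v_factor :
  (1 - t1 * c_series K) * fps_subst h (t1 + t2) = fps_subst h t2.
Proof.
apply: (fps2_mulfI tD_neq0).
have -> : (t1 + t2) * ((1 - t1 * c_series K) * fps_subst h (t1 + t2)) =
    c_den K - t1 * (c_series K * c_den K).
  by rewrite -tD_subst_h; ring.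
rewrite c_seriesP // /c_den exp_tD /c_num.
have -> : fps_subst (fps_exp K) t1 = t1 * fps_subst h t1 + 1.
  by rewrite t1_subst_h subrK.
have -> : fps_subst (fps_exp K) t2 = t2 * fps_subst h t2 + 1.
  by rewrite t2_subst_h subrK.
have alg (x y f g : fps2 K) :
  (x * f + 1) * (y * g + 1) - 1 - x * ((y * g + 1) * f - g) = (x + y) * g by ring.
exact: alg.
Qed.

(** The same cancellation; the right-hand side is h(t1) e^t2 in the form produced by composing the
    exponentials. *)
Lemma c_u_factor : (1 + t2 * c_series K) * fps_subst h (t1 + t2) =
  fps_subst h t1 * (1 + t2 * fps_subst h t2).
Proof.
apply: (fps2_mulfI tD_neq0).
have -> : (t1 + t2) * ((1 + t2 * c_series K) * fps_subst h (t1 + t2)) =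
    c_den K + t2 * (c_series K * c_den K).
  by rewrite -tD_subst_h; ring.
rewrite c_seriesP // /c_den exp_tD /c_num.
have -> : fps_subst (fps_exp K) t1 = t1 * fps_subst h t1 + 1.
  by rewrite t1_subst_h subrK.
have -> : fps_subst (fps_exp K) t2 = t2 * fps_subst h t2 + 1.
  by rewrite t2_subst_h subrK.
have alg (x y f g : fps2 K) : (x * f + 1) * (y * g + 1) - 1 +
  y * ((y * g + 1) * f - g) = (x + y) * (f * (1 + y * g)) by ring.
exact: alg.
Qed.

(** Invertibility is tested twice, first in K[[t1]] and then in K[[t1]][[t2]]; the constant term is
    1. *)
Lemma h_tD_inv : exists q, q * fps_subst h (t1 + t2) = 1.
Proof.
have [q0 q0P] : exists q0, q0 * coefs (fps_subst h (t1 + t2)) 0 = 1.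
  apply: (@fps_inv_exists _ _ 1); rewrite mul1r.
  by rewrite -[LHS]/(coef2 _ 0 0) coef2_subst_tD coef_h mulr1 invr1.
exact: fps_inv_exists q0P.
Qed.

End SeriesIdentities.

(** * The Baker-Campbell-Hausdorff formula *)

Section BakerCampbellHausdorff.
Variables (K : fieldType) (m : nat).
Hypotheses (charK : [pchar K] =i pred0) (hm : (2 <= m)%N).
Local Notation hat := (fm_hat K m).
Local Notation h12 := (fps_subst (h_series K) (t1 K + t2 K)).
Variables (a b : hat).
Local Notation "p ** f" := (ps_act p a b f) (at level 40).

Lemma ps_actBr p f g : p ** (f - g) = p ** f - p ** g.
Proof. by have := ps_actP a b p (-1) g f; rewrite !scaleN1r ![- _ + _]addrC. Qed.

Lemma ps_actBl p q f : (p - q) ** f = p ** f - q ** f.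
Proof. by rewrite -[p in RHS](subrK q) [in RHS]ps_actDl addrK. Qed.

Lemma lieb_ps_act p x f : derived1 f -> ⟦x, p ** f⟧ = p ** ⟦x, f⟧.
Proof.
move=> df; rewrite liebC [⟦x, f⟧]liebC -(sub0r ⟦f, x⟧) ps_actBr.
rewrite -[0 in RHS](subrr f) ps_actBr subrr sub0r; congr (- _).
exact: adr_ps_act.
Qed.

(** The difference [u - u'] lies in the commutator ideal, which is abelian. *)
Lemma adr_linear_part (u u' f : hat) : u 1 = u' 1 -> derived1 f -> adr u f = adr u' f.
Proof.
move=> uu' df; rewrite -[u](subrK u') /adr liebDr.
rewrite (derived1_abelian (@hat_metabelian K m) df) ?add0r //.
by apply/hat_derived1P; rewrite hat_compD -scaleN1r hat_compZ uu' scaleN1r subrr.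
Qed.

Lemma exp_ad1 (u x : hat) : u 1 = a 1 ->
  exp_ad u x = x + fps_subst (h_series K) (t1 K) ** ⟦x, u⟧.
Proof.
move=> ua; apply: exp_adE; first exact: t1_order.
by move=> f df; rewrite ps_act_t1 (adr_linear_part ua).
Qed.

Lemma exp_ad2 (u x : hat) : u 1 = b 1 ->
  exp_ad u x = x + fps_subst (h_series K) (t2 K) ** ⟦x, u⟧.
Proof.
move=> ub; apply: exp_adE; first exact: t2_order.
by move=> f df; rewrite ps_act_t2 (adr_linear_part ub).
Qed.

Lemma exp_adD (u x : hat) : u 1 = a 1 + b 1 ->
  exp_ad u x = x + h12 ** ⟦x, u⟧.
Proof.
move=> uab; apply: exp_adE; first exact: tD_order.
move=> f df; rewrite ps_actDl ps_act_t1 ps_act_t2 /adr -liebDr.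
by apply/esym/adr_linear_part.
Qed.

Definition hat_gen (k : 'I_m) : hat := hat_single (lspan_sub (lm_gen K k)).

Lemma hat_gen_br k (z : hat) d : ⟦hat_gen k, z⟧ d.+1 = ⟦fm_gen K k, z d⟧.
Proof.
rewrite hat_comp_br (bigD1 (Ordinal (isT : 1 < d.+2)%N)) //= subSS subn0.
by rewrite big1 ?addr0 // => i; rewrite -val_eqE /= => /negPf ->; rewrite lie0b.
Qed.

Lemma hat_centre (z : hat) : (forall x, ⟦x, z⟧ = 0) -> z = 0.
Proof.
move=> cz; apply: hatP => d; apply: (free_metab_centre charK hm (hat_homog z d)) => k.
by rewrite liebC -hat_gen_br cz oppr0.
Qed.

(** Terms with two or more brackets start in degree 3. *)
Lemma exp_ad_comp2 (w x : hat) : exp_ad w x 2 = x 2 + ⟦x, w⟧ 2.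
Proof.
rewrite -[LHS]/(\sum_(k < 3) exp_term w x k 2) !big_ord_recl big_ord0 addr0.
rewrite /exp_term !hat_compZ fact0 invr1 !scale1r; congr (_ + _).
rewrite (@iter_adr_order _ _ w x 2 1) ?scaler0 ?addr0 //.
by move=> [|//] _; apply: hat_comp0.
Qed.

Lemma exp_ad_inj (w w' : hat) : w' 1 = a 1 + b 1 ->
  (forall x, exp_ad w x = exp_ad w' x) -> w = w'.
Proof.
move=> w'ab eww.
(* [exp_adD] requires the linear part of [w], so this comes first, from degree 2 on the
   generators. *)
have ww' : w 1 = w' 1.
  apply/eqP; rewrite -subr_eq0; apply/eqP.
  have hww' : Defs.homog 1 (w 1 - w' 1).
    by apply: lspanD; [|apply: lspanN]; apply: hat_homog.
  apply: (free_metab_centre charK hm hww') => k; rewrite liebC liebDr liebNr.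
  have := congr1 (fun f : hat => f 2) (eww (hat_gen k)).
  by rewrite !exp_ad_comp2 => /addrI; rewrite !hat_gen_br => ->; rewrite subrr oppr0.
apply/eqP; rewrite -subr_eq0; apply/eqP/hat_centre => x.
(* One series now serves both exponentials, and its inverse [q] recovers the brackets. *)
have := eww x; rewrite !exp_adD ?ww' // => /addrI eh.
have [q qh] := h_tD_inv K.
rewrite liebDr liebNr -[⟦x, w⟧](ps_act1 a b) -[⟦x, w'⟧](ps_act1 a b) -qh.
by rewrite !ps_actM ?eh ?subrr //; apply: derived1_br.
Qed.

(** Meant for [p], [p1], [p2] equal to h at t1 + t2, t1, t2, with [X] and [Y] the brackets of x with
    u and v; the term [adr b (p1 ** X)] is the second exponential acting on the correction made by
    the first. *)
Lemma bch_series (p p1 p2 q r : fps2 K) (X Y : hat) : derived1 X -> derived1 Y ->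
    q * p = p1 * (1 + t2 K * p2) -> r * p = p2 ->
  p ** (q ** X + r ** Y) = p1 ** X + p2 ** (Y + adr b (p1 ** X)).
Proof.
move=> dX dY qp rp; rewrite !ps_actDr -!ps_actM // ![p * _]mulrC rp qp.
rewrite mulrDr mulr1 ps_actDl addrAC addrA; congr (_ + _ + _).
rewrite -(ps_act_t2 a) -!ps_actM //; last exact: ps_act_derived1.
congr (ps_act _ a b X).
by rewrite [RHS]mulrC (mulrC p2).
Qed.

Lemma bch_solution (u v u0 v0 x : hat) : derived1 u0 -> derived1 v0 ->
    u = a + u0 -> v = b + v0 ->
  exp_ad v (exp_ad u x) = exp_ad (H_lin a b + (1 + t2 K * c_series K) ** u0
      + (1 - t1 K * c_series K) ** v0) x.
Proof.
move=> du dv uE vE; set w := H_lin a b + _ + _.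
have comp1 (f : hat) : derived1 f -> f 1 = 0 by move/hat_derived1P.
have dbr (y z : hat) : derived1 ⟦y, z⟧ by apply: derived1_br.
have u1 : u 1 = a 1 by rewrite uE hat_compD (comp1 _ du) addr0.
have v1 : v 1 = b 1 by rewrite vE hat_compD (comp1 _ dv) addr0.
have w1 : w 1 = a 1 + b 1.
  by rewrite /w /H_lin !hat_compD !(comp1 (_ ** _)) ?addr0 //; exact: ps_act_derived1.
have xw : ⟦x, w⟧ =
    (1 + t2 K * c_series K) ** ⟦x, u⟧ + (1 - t1 K * c_series K) ** ⟦x, v⟧.
  (* Leibniz on [⟦x, ⟦a, b⟧⟧] yields t2 c on [⟦x, a⟧] and -t1 c on [⟦x, b⟧], so linear parts get the
     same coefficients as [u0] and [v0]. *)
  rewrite /w /H_lin !liebDr !lieb_ps_act // lieb_leibniz.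
  rewrite -/(adr b ⟦x, a⟧) -/(adr a ⟦x, b⟧) -(ps_act_t2 a) -(ps_act_t1 a b).
  rewrite ps_actBr -!ps_actM // ![c_series K * _]mulrC uE vE !liebDr !ps_actDr.
  rewrite [_ ** ⟦x, a⟧ in RHS]ps_actDl [_ ** ⟦x, b⟧ in RHS]ps_actBl !ps_act1.
  set A := ⟦x, a⟧; set B := ⟦x, b⟧; set A' := _ ** A; set B' := _ ** B.
  have shuffle (V : zmodType) (p q r s t e : V) :
      p + q + (r - s) + t + e = p + r + t + (q - s + e).
    by rewrite (addrACA p q r) (addrAC (p + r)) -!addrA.
  exact: shuffle.
rewrite (exp_ad1 _ u1) (exp_ad2 _ v1) (exp_adD _ w1) xw liebDl.
rewrite -addrA; congr (_ + _).
rewrite -/(adr v (_ ** _)) (adr_linear_part v1); last exact: ps_act_derived1.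
apply/esym/bch_series => //; [exact: c_u_factor | exact: c_v_factor].
Qed.

End BakerCampbellHausdorff.

(* The parts u0, v0 range over the commutator ideal of the completion.  The
   operator product is a right composition: exp (ad u) is applied first. *)
Theorem theorem4 (K : fieldType) (charK : [pchar K] =i pred0)
    (m : nat) (hm : (2 <= m)%N)
    (u v ub vb u0 v0 : fm_hat K m)
    (ub_lin : hat_linear ub) (vb_lin : hat_linear vb)
    (u0_comm : derived1 u0) (v0_comm : derived1 v0)
    (uE : u = ub + u0) (vE : v = vb + v0) (w : fm_hat K m) :
  (forall x : fm_hat K m, exp_ad v (exp_ad u x) = exp_ad w x) <->
  w = H_lin ub vb
      + ps_act (1 + t2 K * c_series K) ub vb u0
      + ps_act (1 - t1 K * c_series K) ub vb v0.
Proof.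
have sol x := bch_solution charK x u0_comm v0_comm uE vE.
(* By [sol] the formula and [w] have the same exponential; for [exp_ad_inj] it remains to find the
   linear part of the formula. *)
split=> [ew|-> //]; apply: (@exp_ad_inj K m charK hm ub vb) => [|x].
  have c1 (f : fm_hat K m) : derived1 f -> f 1 = 0 by move/hat_derived1P.
  rewrite !hat_compD !(c1 (ps_act _ _ _ _)) ?addr0 //; apply: ps_act_derived1 => //.
  exact: derived1_br.
by rewrite -ew sol.
Qed.
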